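(* Let $\mathbb{T}$ be one of $\mathbb{R}$, $\mathbb{R}_+=[0,\infty)$ or $\mathbb{R}_{++}=(0,\infty)$, and let $(X_t)_{t\in\mathbb{T}}$ be a real-valued stochastic process. (i) If $(X_t)_{t\in\mathbb{T}}$ is an $(\alpha,\delta)$-dilatively stable process for some $(\alpha,\delta)\in\mathbb{R}\times(\mathbb{R}\setminus\{0\})$, then it is $\left(\frac12-\frac{\alpha}{\delta},\,-\frac{1}{\delta}\right)$-aggregate similar. (ii) If $(X_t)_{t\in\mathbb{T}}$ is infinitely divisible, its finite-dimensional distributions are weakly right-continuous, and it is $(\varrho_1,\varrho_2)$-aggregate similar for some $(\varrho_1,\varrho_2)\in\mathbb{R}\times(\mathbb{R}\setminus\{0\})$, then it is $\left(\frac{\varrho_1}{\varrho_2}-\frac{1}{2\varrho_2},\,-\frac{1}{\varrho_2}\right)$-dilatively stable.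
   Context: All processes are defined on a probability space $(\Omega,\mathcal{F},\mathbb{P})$; $\mathbb{N}$ denotes the set of positive integers. A process $(X_t)_{t\in\mathbb{T}}$ is called infinitely divisible if all its finite-dimensional distributions are infinitely divisible. For an infinitely divisible process and $k\in\mathbb{N}$, $t_1,\ldots,t_k\in\mathbb{T}$, the characteristic exponent of $(X_{t_1},\ldots,X_{t_k})$ is the unique continuous function $\psi_{t_1,\ldots,t_k}:\mathbb{R}^k\to\mathbb{C}$ with $\psi_{t_1,\ldots,t_k}(0,\ldots,0)=0$ and $$\mathbb{E}\left(e^{i\sum_{j=1}^k\theta_jX_{t_j}}\right)=e^{-\psi_{t_1,\ldots,t_k}(\theta_1,\ldots,\theta_k)}\quad\text{for all }\theta_1,\ldots,\theta_k\in\mathbb{R}.$$ For $\alpha,\delta\in\mathbb{R}$, an infinitely divisible process $(X_t)_{t\in\mathbb{T}}$ is called $(\alpha,\delta)$-dilatively stable if $$\psi_{Tt_1,\ldots,Tt_k}(\theta_1,\ldots,\theta_k)=T^{\delta}\,\psi_{t_1,\ldots,t_k}\left(T^{\alpha-\frac{\delta}{2}}\theta_1,\ldots,T^{\alpha-\frac{\delta}{2}}\theta_k\right)$$ for all $T>0$, $k\in\mathbb{N}$, $\theta_1,\ldots,\theta_k\in\mathbb{R}$, $t_1,\ldots,t_k\in\mathbb{T}$. For $\varrho_1,\varrho_2\in\mathbb{R}$, a process $(X_t)_{t\in\mathbb{T}}$ is called $(\varrho_1,\varrho_2)$-aggregate similar if for every $m\in\mathbb{N}$ the processes $\left(\sum_{i=1}^mX^{(i)}_t\right)_{t\in\mathbb{T}}$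 and $\left(m^{\varrho_1}X_{m^{-\varrho_2}t}\right)_{t\in\mathbb{T}}$ have the same finite-dimensional distributions, where $(X^{(i)}_t)_{t\in\mathbb{T}}$, $i\in\mathbb{N}$, are independent identically distributed copies of $(X_t)_{t\in\mathbb{T}}$. The finite-dimensional distributions are weakly right-continuous if for all $k\in\mathbb{N}$, $t_1,\ldots,t_k\in\mathbb{T}$ and all sequences $t_j^{(n)}\in\mathbb{T}$ with $t_j^{(n)}\geq t_j$ and $t_j^{(n)}\to t_j$ as $n\to\infty$ ($j=1,\ldots,k$), the random vectors $(X_{t_1^{(n)}},\ldots,X_{t_k^{(n)}})$ converge in distribution to $(X_{t_1},\ldots,X_{t_k})$. *)

(* Defs.v *)
From HB Require Import structures.
From mathcomp Require Import all_boot all_order all_algebra.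
From mathcomp Require Import complex.
From mathcomp Require Import all_classical all_reals all_analysis.

Set Implicit Arguments.
Unset Strict Implicit.
Unset Printing Implicit Defensive.

Import Order.TTheory GRing.Theory Num.Theory.
Import numFieldNormedType.Exports.

Local Open Scope classical_set_scope.
Local Open Scope complex_scope.
Local Open Scope ring_scope.

Section RandomVectors.
Context {R : realType}.

(* Random vectors in R^k take values in [k.-tuple R], which carries the product
   of the Borel sigma-algebras; ['rV[R]_k] is used where the topology of R^k is
   needed. *)

Definition tuple_row k (x : k.-tuple R) : 'rV[R]_k := \row_j tnth x j.

Definition same_law d (Omega : measurableType d) (P : probability Omega R)
    d' (Omega' : measurableType d') (P' : probability Omega' R)
    k (Z : Omega -> k.-tuple R) (Z' : Omega' -> k.-tuple R) : Prop :=
  forall B : set (k.-tuple R), measurable B -> P (Z @^-1` B) = P' (Z' @^-1` B).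

(* Subfamilies are covered by taking [A i = setT]. *)
Definition independent_sigma d (Omega : measurableType d)
    (P : probability Omega R) m (F : 'I_m -> set (set Omega)) : Prop :=
  forall A : 'I_m -> set Omega, (forall i, F i (A i)) ->
    P (\bigcap_i A i) = (\prod_i P (A i))%E.

Definition independent_vectors d (Omega : measurableType d)
    (P : probability Omega R) m k (Y : 'I_m -> Omega -> k.-tuple R) : Prop :=
  independent_sigma P
    (fun i => preimage_set_system [set: Omega] (Y i) measurable).

Definition infinitely_divisible_vector d (Omega : measurableType d)
    (P : probability Omega R) k (Z : Omega -> k.-tuple R) : Prop :=
  forall n : nat, (0 < n)%N ->
    exists (d' : measure_display) (Omega' : measurableType d')
           (P' : probability Omega' R) (Y : 'I_n -> Omega' -> k.-tuple R),
      [/\ forall i, measurable_fun [set: Omega'] (Y i),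
          independent_vectors P' Y,
          forall i j, same_law P' P' (Y i) (Y j) &
          same_law P P' Z
            (fun w => [tuple \sum_(i < n) tnth (Y i w) j | j < k])].

Definition cexp (z : R[i]) : R[i] :=
  (expR (complex.Re z) * cos (complex.Im z)) +i*
  (expR (complex.Re z) * sin (complex.Im z)).

Definition cexpectation d (Omega : measurableType d) (P : probability Omega R)
    (f : Omega -> R[i]) : R[i] :=
  (\int[P]_w complex.Re (f w)) +i* (\int[P]_w complex.Im (f w)).

Definition char_fun d (Omega : measurableType d) (P : probability Omega R)
    k (Z : Omega -> k.-tuple R) (theta : 'rV[R]_k) : R[i] :=
  cexpectation P
    (fun w => cexp ('i%C * (\sum_(j < k) theta 0 j * tnth (Z w) j)%:C)).

Definition is_char_exponent d (Omega : measurableType d)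
    (P : probability Omega R) k (Z : Omega -> k.-tuple R)
    (psi : 'rV[R]_k -> R[i]) : Prop :=
  [/\ continuous (psi : 'rV[R]_k -> R[i]^o),
      psi 0 = 0 &
      forall theta, char_fun P Z theta = cexp (- psi theta)].

(* Such a [psi] exists and is unique when [Z] is infinitely divisible; the
   default value [0] is only taken when no [psi] exists. *)
Definition char_exponent d (Omega : measurableType d) (P : probability Omega R)
    k (Z : Omega -> k.-tuple R) : 'rV[R]_k -> R[i] :=
  xget (fun=> 0) [set psi | is_char_exponent P Z psi].

Definition cvg_in_distribution d (Omega : measurableType d)
    (P : probability Omega R) k (Zn : nat -> Omega -> k.-tuple R)
    (Z : Omega -> k.-tuple R) : Prop :=
  forall f : 'rV[R]_k -> R, continuous f ->
    (exists M : R, forall x, `|f x| <= M) ->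
    (fun n => \int[P]_w f (tuple_row (Zn n w))) @ \oo -->
      \int[P]_w f (tuple_row (Z w)).

End RandomVectors.

Section Processes.
Context {R : realType}.

(* A process indexed by [TT] is a function on all of R whose values at times
   outside [TT] are never used. *)

Definition time_domain (TT : set R) : Prop :=
  [\/ TT = [set: R], TT = `[0, +oo[%classic | TT = `]0, +oo[%classic].

Definition stochastic_process d (Omega : measurableType d) (TT : set R)
    (X : R -> Omega -> R) : Prop :=
  forall t, TT t -> measurable_fun [set: Omega] (X t).

Definition fd_vector (Omega : Type) (X : R -> Omega -> R) k (t : 'I_k -> R)
    (w : Omega) : k.-tuple R :=
  [tuple X (t j) w | j < k].

Definition same_fdd d (Omega : measurableType d) (P : probability Omega R)
    d' (Omega' : measurableType d') (P' : probability Omega' R) (TT : set R)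
    (X : R -> Omega -> R) (X' : R -> Omega' -> R) : Prop :=
  forall (k : nat) (t : 'I_k -> R), (0 < k)%N -> (forall j, TT (t j)) ->
    same_law P P' (fd_vector X t) (fd_vector X' t).

Definition process_sigma (Omega : Type) (TT : set R) (X : R -> Omega -> R) : set (set Omega) :=
  <<s \bigcup_(t in TT) preimage_set_system [set: Omega] (X t) measurable >>.

Definition independent_processes d (Omega : measurableType d)
    (P : probability Omega R) (TT : set R) m
    (Y : 'I_m -> R -> Omega -> R) : Prop :=
  independent_sigma P (fun i => process_sigma TT (Y i)).

Definition infinitely_divisible d (Omega : measurableType d)
    (P : probability Omega R) (TT : set R) (X : R -> Omega -> R) : Prop :=
  forall (k : nat) (t : 'I_k -> R), (0 < k)%N -> (forall j, TT (t j)) ->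
    infinitely_divisible_vector P (fd_vector X t).

Definition dilatively_stable d (Omega : measurableType d)
    (P : probability Omega R) (TT : set R) (alpha delta : R)
    (X : R -> Omega -> R) : Prop :=
  infinitely_divisible P TT X /\
  forall (T : R) (k : nat) (theta : 'rV[R]_k) (t : 'I_k -> R),
    0 < T -> (0 < k)%N -> (forall j, TT (t j)) ->
    char_exponent P (fd_vector X (fun j => T * t j)) theta =
    (T `^ delta)%:C *
      char_exponent P (fd_vector X t) (T `^ (alpha - delta / 2) *: theta).

(* The independent copies may live on any probability space. *)
Definition aggregate_similar d (Omega : measurableType d)
    (P : probability Omega R) (TT : set R) (rho1 rho2 : R)
    (X : R -> Omega -> R) : Prop :=
  forall m : nat, (0 < m)%N ->
  forall (d' : measure_display) (Omega' : measurableType d')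
         (P' : probability Omega' R) (Y : 'I_m -> R -> Omega' -> R),
    (forall i, stochastic_process TT (Y i)) ->
    independent_processes P' TT Y ->
    (forall i, same_fdd P' P TT (Y i) X) ->
    same_fdd P' P TT
      (fun t w => \sum_(i < m) Y i t w)
      (fun t w => m%:R `^ rho1 * X (m%:R `^ (- rho2) * t) w).

Definition weakly_right_continuous d (Omega : measurableType d)
    (P : probability Omega R) (TT : set R) (X : R -> Omega -> R) : Prop :=
  forall (k : nat) (t : 'I_k -> R) (tn : nat -> 'I_k -> R),
    (0 < k)%N -> (forall j, TT (t j)) -> (forall n j, TT (tn n j)) ->
    (forall n j, t j <= tn n j) ->
    (forall j, (fun n => tn n j) @ \oo --> t j) ->
    cvg_in_distribution P (fun n => fd_vector X (tn n)) (fd_vector X t).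

End Processes.

(* Main.v *)
Require Import Defs.
From HB Require Import structures.
From mathcomp Require Import all_boot all_order all_algebra.
From mathcomp Require Import complex ring lra finmap.
From mathcomp Require Import all_classical all_reals all_analysis measurable_realfun.

Import Order.TTheory GRing.Theory Num.Theory.
Import numFieldNormedType.Exports.

Local Open Scope classical_set_scope.
Local Open Scope ring_scope.

(** Write phi_t = exp (- psi_t) for the characteristic function and the
    characteristic exponent of (X_{t_1}, ..., X_{t_k}). The sum of m independent
    copies of X has the characteristic functions phi_t ^ m = exp (- m psi_t), and
    m^rho1 X_{m^(-rho2) t} has the characteristic functions
    theta |-> phi_{m^(-rho2) t} (m^rho1 theta). Hence aggregate similarity means
      psi_{m^(-rho2) t} (theta) = m psi_t (m^(-rho1) theta)   for all m >= 1,
    which is the identity of dilative stability for the factors T = m^(-rho2).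

    This gives the first implication with T = m^(1/delta), because a law is
    determined by its characteristic function (char_fun_inj). For the second one,
    composing the identity for m with the inverse of another one yields it for
    T = q^(-rho2) with q a positive rational, and the remaining T are reached by
    right-continuity. When the t_j have different signs, no sequence q makes all
    times q^(-rho2) t_j approach from the right. The times
    max (T t_j, q^(-rho2) t_j) do, and so do their quotients by q^(-rho2), which
    tend to t_j; the identity for q relates these two families.

    Four facts about characteristic functions carry the argument.
    - char_fun_inj: the functions with equal expectations under two laws form a
      class closed under bounded limits. If it contains the cosines, it contains
      everything that iterated bounded limits make from them, and these include
      the indicators of the boxes x_j > a_j.
    - char_fun_sum, with independent_process_copies: independence turns sums into
      products, and independent copies exist. Existence matters, since aggregate
      similarity speaks of all families of copies and is used as a hypothesis.
    - id_char_exponentP: an infinitely divisible phi has no zero, because the n-th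
      roots of phi (theta) approach the unit circle, which keeps phi (2 theta) away
      from 0; a continuous argument is then lifted along each ray.
    - char_exponent_cvg: convergence in distribution implies convergence of the
      exponents at convergent points of a ray. A modulus of continuity given by
      a bounded continuous test function (osc) makes the convergence of the
      characteristic functions uniform on rays, and then the arguments can be
      compared. *)

Set Implicit Arguments.
Unset Strict Implicit.
Unset Printing Implicit Defensive.

(** * Bounded measurable functions and their expectations *)

Lemma cvg_norm_le (R : realType) (u : nat -> R) (l M : R) :
  (forall n, `|u n| <= M) -> u n @[n --> \oo] --> l -> `|l| <= M.
Proof.
move=> uM /cvg_norm cu; rewrite -(cvg_lim _ cu)//; apply: limr_le.
  by apply/cvg_ex; eexists; exact: cu.
by near=> n; exact: uM.
Unshelve. all: by end_near. Qed.

Section BoundedMeasurable.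
Context {R : realType} d (T : measurableType d).
Implicit Types f g : T -> R.

Definition bounded_measurable f :=
  measurable_fun [set: T] f /\ exists M, forall x, `|f x| <= M.

Lemma bounded_measurableD f g : bounded_measurable f -> bounded_measurable g ->
  bounded_measurable (fun x => f x + g x).
Proof.
move=> [mf [M fM]] [mg [N gN]]; split; first exact: measurable_funD.
by exists (M + N) => x; rewrite (le_trans (ler_normD _ _))// lerD.
Qed.

Lemma bounded_measurableM f g : bounded_measurable f -> bounded_measurable g ->
  bounded_measurable (fun x => f x * g x).
Proof.
move=> [mf [M fM]] [mg [N gN]]; split; first exact: measurable_funM.
by exists (M * N) => x; rewrite normrM ler_pM.
Qed.

Lemma bounded_measurable_cst (c : R) : bounded_measurable (fun _ : T => c).
Proof. by split => //; exists `|c|. Qed.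

Lemma bounded_measurableZ (c : R) f : bounded_measurable f ->
  bounded_measurable (fun x => c * f x).
Proof. by apply: bounded_measurableM; exact: bounded_measurable_cst. Qed.

Lemma bounded_measurableB f g : bounded_measurable f -> bounded_measurable g ->
  bounded_measurable (fun x => f x - g x).
Proof.
move=> bf bg; under eq_fun do rewrite -(mulN1r (g _)).
exact: (bounded_measurableD bf (bounded_measurableZ _ bg)).
Qed.

Lemma bounded_measurable_norm f : bounded_measurable f ->
  bounded_measurable (fun x => `|f x|).
Proof.
move=> [mf [M fM]]; split; first exact: measurableT_comp.
by exists M => x; rewrite normr_id.
Qed.

Lemma bounded_measurable_prod (I : Type) (s : seq I) (P : pred I)
    (F : I -> T -> R) : (forall i, bounded_measurable (F i)) ->
  bounded_measurable (fun x => \prod_(i <- s | P i) F i x).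
Proof.
move=> bF; elim: s => [|i s IHs].
  by under eq_fun do rewrite big_nil; exact: bounded_measurable_cst.
under eq_fun do rewrite big_cons; case: (P i) => //.
exact: bounded_measurableM.
Qed.

Lemma bounded_measurable_indic (A : set T) : measurable A ->
  bounded_measurable (\1_A : T -> R).
Proof.
move=> mA; split; first exact: measurable_indic.
by exists 1 => x; rewrite indicE; case: (_ \in _); rewrite ?normr1// normr0.
Qed.

Lemma bounded_measurable_lim (h : nat -> T -> R) f M :
  (forall n, measurable_fun [set: T] (h n)) -> (forall n x, `|h n x| <= M) ->
  (forall x, h ^~ x @ \oo --> f x) -> bounded_measurable f.
Proof.
move=> mh hM hf; split; first by apply: measurable_fun_cvg => // x _; exact: hf.
by exists M => x; apply: (cvg_norm_le _ (hf x)) => n; exact: hM.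
Qed.

Lemma bounded_measurable_cos f : measurable_fun [set: T] f ->
  bounded_measurable (fun x => cos (f x)).
Proof.
move=> mf; split; last by exists 1 => x; exact: cos_max.
apply: measurableT_comp => //; apply: continuous_measurable_fun.
exact: continuous_cos.
Qed.

Lemma bounded_measurable_sin f : measurable_fun [set: T] f ->
  bounded_measurable (fun x => sin (f x)).
Proof.
move=> mf; split; last by exists 1 => x; exact: sin_max.
apply: measurableT_comp => //; apply: continuous_measurable_fun.
exact: continuous_sin.
Qed.

End BoundedMeasurable.

Lemma bounded_measurable_comp {R : realType} d (T : measurableType d) d'
    (T' : measurableType d') (phi : T' -> T) (f : T -> R) :
  measurable_fun [set: T'] phi -> bounded_measurable f ->
  bounded_measurable (f \o phi).
Proof.
move=> mphi [mf [M fM]]; split; first exact: measurableT_comp.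
by exists M => x; exact: fM.
Qed.

Section Expectation.
Context {R : realType} d (T : measurableType d) (P : probability T R).
Implicit Types f g : T -> R.

Lemma bounded_integrable f : bounded_measurable f ->
  P.-integrable [set: T] (EFin \o f).
Proof.
move=> [mf [M fM]]; apply: measurable_bounded_integrable => //.
  exact: fin_num_fun_lty.
by exists M; split; [exact: num_real|move=> N MN x _; exact: le_trans (ltW MN)].
Qed.

Lemma expectD f g : bounded_measurable f -> bounded_measurable g ->
  \int[P]_x (f x + g x) = \int[P]_x f x + \int[P]_x g x.
Proof. by move=> bf bg; rewrite RintegralD//; exact: bounded_integrable. Qed.

Lemma expectB f g : bounded_measurable f -> bounded_measurable g ->
  \int[P]_x (f x - g x) = \int[P]_x f x - \int[P]_x g x.
Proof. by move=> bf bg; rewrite RintegralB//; exact: bounded_integrable. Qed.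

Lemma expectZ (c : R) f : bounded_measurable f ->
  \int[P]_x (c * f x) = c * \int[P]_x f x.
Proof. by move=> bf; rewrite RintegralZl//; exact: bounded_integrable. Qed.

Lemma expect_cst (c : R) : \int[P]_x c = c.
Proof. by rewrite Rintegral_cst//= probability_setT/= mulr1. Qed.

Lemma le_expect f g : bounded_measurable f -> bounded_measurable g ->
  (forall x, f x <= g x) -> \int[P]_x f x <= \int[P]_x g x.
Proof. by move=> bf bg fg; apply: le_Rintegral => //; exact: bounded_integrable. Qed.

Lemma norm_expect_le f g : bounded_measurable f -> bounded_measurable g ->
  (forall x, `|f x| <= g x) -> `|\int[P]_x f x| <= \int[P]_x g x.
Proof.
move=> bf bg fg.
apply: (le_trans (le_normr_Rintegral measurableT (bounded_integrable bf))).
by apply: le_expect => //; exact: bounded_measurable_norm.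
Qed.

Lemma expect_indic (A : set T) : measurable A ->
  \int[P]_x (\1_A x) = fine (P A).
Proof. by move=> mA; rewrite /Rintegral integral_indic// setIT. Qed.

(** The limit arguments below only need this case of dominated convergence. *)
Lemma expect_cvg (h : nat -> T -> R) f M :
  (forall n, measurable_fun [set: T] (h n)) -> (forall n x, `|h n x| <= M) ->
  (forall x, h ^~ x @ \oo --> f x) ->
  (fun n => \int[P]_x h n x) @ \oo --> \int[P]_x f x.
Proof.
move=> mh hM hf.
have bf : bounded_measurable f by exact: bounded_measurable_lim hf.
have [] := @dominated_convergence _ _ _ P _ measurableT
  (fun n => EFin \o h n) (EFin \o f) (cst M%:E).
- by move=> n; apply/measurable_EFinP.
- by apply/measurable_EFinP; case: bf.
- by apply: aeW => x _; apply: cvg_EFin; [near=> n|exact: hf].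
- apply: (bounded_integrable (f := fun=> M)).
  exact: bounded_measurable_cst.
- by apply: aeW => x n _ /=; rewrite lee_fin.
move=> _ _ cv; apply: fine_cvg.
rewrite fineK; first exact: cv.
exact: integrable_fin_num (bounded_integrable bf).
Unshelve. all: by end_near. Qed.

End Expectation.

(** * Classes of functions closed under bounded limits *)

Import HBSimple.
Import HBNNSimple.

Section MonotoneClass.
Context {R : realType}.

(** Unlike in the usual monotone class theorem, the limits need not be monotone:
    bounded convergence is available for expectations, and it is what the
    trigonometric approximations below require. *)
Record bounded_limit_closed (T : Type) (V : (T -> R) -> Prop) : Prop := {
  blcD : forall f g, V f -> V g -> V (fun x => f x + g x);
  blcZ : forall c f, V f -> V (fun x => c * f x);
  blc_lim : forall (h : nat -> T -> R) f M, (forall n, V (h n)) ->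
    (forall n x, `|h n x| <= M) -> (forall x, h ^~ x @ \oo --> f x) -> V f }.

Lemma blc_sum (T : Type) (V : (T -> R) -> Prop) (I : Type) (s : seq I)
    (F : I -> T -> R) : bounded_limit_closed V -> V (fun _ => 0) ->
  (forall i, V (F i)) -> V (fun x => \sum_(i <- s) F i x).
Proof.
move=> cV V0 VF; elim: s => [|i s IHs].
  by under eq_fun do rewrite big_nil.
by under eq_fun do rewrite big_cons; exact: blcD.
Qed.

(** A nonnegative bounded f is the increasing limit of simple functions that lie
    below it, and the general case follows by adding a constant. *)
Lemma blc_bounded_measurable d (T : measurableType d) (V : (T -> R) -> Prop) :
  bounded_limit_closed V -> (forall A, measurable A -> V (\1_A)) ->
  forall f, bounded_measurable f -> V f.
Proof.
move=> cV VI f [mf [M fM]].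
have V1 : V (fun=> 1).
  have -> : (fun=> 1) = \1_[set: T] :> (T -> R).
    by apply/funext => x; rewrite indicE in_setT.
  exact: VI.
have V0 : V (fun=> 0).
  by have := blcZ cV 0 V1; under eq_fun do rewrite mul0r.
have Vf1 g : (forall x, 0 <= g x) -> bounded_measurable g -> V g.
  move=> g0 [mg [N gN]].
  have mEg : measurable_fun [set: T] (EFin \o g) by exact/measurable_EFinP.
  pose h n := nnsfun_approx measurableT mEg n.
  have hg x : (fun n => h n x) @ \oo --> g x.
    have g0' y : [set: T] y -> (0 <= (EFin \o g) y)%E by rewrite lee_fin.
    by have /fine_cvgP[_] := cvg_nnsfun_approx measurableT mEg g0' (I : setT x).
  have hle n x : h n x <= g x.
    have nd : nondecreasing_seq (fun n => h n x).
      by move=> a b ab; exact/lefP/(nd_nnsfun_approx measurableT mEg ab).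
    by have := nondecreasing_cvgn_le nd (cvgP _ (hg x)) n; rewrite (cvg_lim _ (hg x)).
  apply: (blc_lim cV (h := fun n x => h n x) (M := N)) => // [n|n x]; last first.
    by rewrite ger0_norm// (le_trans (hle n x))// (le_trans (ler_norm _))//.
  have -> : (fun x => h n x) = (fun x =>
      \sum_(y <- fset_set (range (h n))) y * \1_(h n @^-1` [set y]) x).
    by apply/funext => x; rewrite fimfunE fsbig_finite.
  apply: blc_sum => // y; apply: blcZ => //; apply: VI.
  exact: measurable_funPTI.
have -> : f = (fun x => (f x + M) + (- M) * 1).
  by apply/funext => x; rewrite mulr1 addrK.
apply: blcD => //; last exact: blcZ.
apply: Vf1 => [x|].
  by rewrite -lerBlDr sub0r; have := fM x; rewrite ler_norml => /andP[].
apply: bounded_measurableD; last exact: bounded_measurable_cst.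
by split => //; exists M.
Unshelve. all: by end_near. Qed.

End MonotoneClass.

(** * Indicators of boxes as limits of trigonometric polynomials *)

Section Threshold.
Context {R : realType}.

Lemma bernoulli_inequality (h : R) n : -1 <= h -> 1 + n%:R * h <= (1 + h) ^+ n.
Proof.
move=> h1; elim: n => [|n IHn]; first by rewrite mul0r addr0 expr0.
have h0 : 0 <= 1 + h by lra.
rewrite exprS; apply: (le_trans _ (ler_wpM2l h0 IHn)).
have n0 : 0 <= n%:R :> R by [].
have h2 : 0 <= h ^+ 2 by exact: sqr_ge0.
by rewrite -natr1; nra.
Qed.

Lemma cvg_natrM_expr (q : R) : 0 <= q -> q < 1 ->
  (fun n => n%:R * q ^+ n) @ \oo --> (0 : R).
Proof.
move=> q0 q1; have [->|qn0] := eqVneq q 0.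
  rewrite -(cvg_shiftn 1)/=; apply: cvg_near_cst; near=> n.
  by rewrite addn1 expr0n mulr0.
set p := Num.sqrt q.
have p0 : 0 < p by rewrite sqrtr_gt0 lt_def qn0.
have pq : p ^+ 2 = q by rewrite sqr_sqrtr.
have p1 : p < 1 by rewrite -sqrtr1 ltr_sqrt.
(* With p = sqrt q, the inequality of Bernoulli bounds n * p ^ n. *)
set h := p^-1 - 1.
have h0 : 0 < h by rewrite subr_gt0 invf_gt1.
have npn n : n%:R * p ^+ n <= h^-1.
  have := @bernoulli_inequality h n (le_trans (lerN10 _) (ltW h0)).
  have -> : 1 + h = p^-1 by rewrite addrC subrK.
  rewrite exprVn => hle; have pn0 : 0 < p ^+ n by exact: exprn_gt0.
  have nh : n%:R * h <= (p ^+ n)^-1 by lra.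
  by rewrite -[h^-1]mul1r ler_pdivlMr// mulrAC -ler_pdivlMr// div1r.
apply: (@squeeze_cvgr _ _ _ _ (fun=> 0) (fun n => h^-1 * p ^+ n)).
- near=> n; rewrite mulr_ge0 ?exprn_ge0//=.
  by rewrite -pq -exprM mul2n -addnn exprD mulrA ler_wpM2r// exprn_ge0// ltW.
- exact: cvg_cst.
- rewrite -[X in _ --> X](mulr0 h^-1); apply: cvgMl_tmp.
  by apply: cvg_expr; rewrite gtr0_norm.
Unshelve. all: by end_near. Qed.

(** For u < 1/2 Bernoulli gives the lower bound 1 - n (2 u)^n. For u >= 1/2 the
    product with (1 + u^n)^(n 2^n) is at most 1, and Bernoulli bounds this factor
    below by 1 + n (2 u)^n. The factor n in the exponent serves u = 1/2, where the
    exponent 2^n alone would give the limit 1/e. *)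
Lemma threshold_poly_cvg (u : R) : 0 <= u <= 1 ->
  (fun n => (1 - u ^+ n) ^+ (n * 2 ^ n)) @ \oo -->
    (if u < 1 / 2 then 1 else 0 : R).
Proof.
move=> /andP[u0 u1]; have un n : 0 <= u ^+ n <= 1.
  by rewrite exprn_ge0// exprn_ile1.
have E n : (n * 2 ^ n)%:R * u ^+ n = n%:R * (2 * u) ^+ n :> R.
  by rewrite natrM natrX exprMn mulrA.
case: ltP => hu.
  apply: (@squeeze_cvgr _ _ _ _ (fun n => 1 - n%:R * (2 * u) ^+ n) (fun=> 1)).
  - near=> n; have /andP[un0 un1] := un n; apply/andP; split.
      rewrite -E -mulrN; apply: bernoulli_inequality; lra.
    by apply: exprn_ile1; lra.
  - rewrite -[X in _ --> X](subr0 1); apply: cvgB; first exact: cvg_cst.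
    by apply: cvg_natrM_expr; lra.
  - exact: cvg_cst.
apply: (@squeeze_cvgr _ _ _ _ (fun=> 0) (@harmonic R)).
- near=> n; have /andP[un0 un1] := un n; apply/andP; split.
    by apply: exprn_ge0; lra.
  set N := (n * 2 ^ n)%N; rewrite /harmonic/=.
  have B : 1 + n%:R <= (1 + u ^+ n) ^+ N.
    apply: (le_trans _ (@bernoulli_inequality _ _ _)); last by lra.
    rewrite E lerD2l ler_peMr// exprn_ege1//; lra.
  have n0 : 0 < 1 + n%:R :> R by rewrite ltr_pwDl.
  rewrite -natr1 [n%:R + 1]addrC -[leRHS]mul1r ler_pdivlMr//.
  apply: (@le_trans _ _ ((1 - u ^+ n) ^+ N * (1 + u ^+ n) ^+ N)).
    by apply: ler_wpM2l => //; apply: exprn_ge0; lra.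
  rewrite -exprMn; apply: exprn_ile1; have := sqr_ge0 (u ^+ n); nra.
- exact: cvg_cst.
- exact: cvg_harmonic.
Unshelve. all: by end_near. Qed.

End Threshold.

Section TrigClosure.
Context {R : realType} (k : nat).

(** The phase c makes the linear span contain the sines as well, and makes it
    closed under products. *)
Inductive trig_closure : (k.-tuple R -> R) -> Prop :=
| trig_cos (theta : 'rV[R]_k) c :
    trig_closure (fun x => cos (\sum_(j < k) theta 0 j * tnth x j + c))
| trigD f g : trig_closure f -> trig_closure g ->
    trig_closure (fun x => f x + g x)
| trigZ c f : trig_closure f -> trig_closure (fun x => c * f x)
| trig_lim (h : nat -> k.-tuple R -> R) f M : (forall n, trig_closure (h n)) ->
    (forall n x, `|h n x| <= M) -> (forall x, h ^~ x @ \oo --> f x) ->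
    trig_closure f.

Lemma trig_closure_bounded f : trig_closure f -> exists M, forall x, `|f x| <= M.
Proof.
elim=> [theta c|{}f g _ [M fM] _ [N gN]|c {}f _ [M fM]|h {}f M _ _ hM hf].
- by exists 1 => x; exact: cos_max.
- by exists (M + N) => x; rewrite (le_trans (ler_normD _ _))// lerD.
- by exists (`|c| * M) => x; rewrite normrM ler_wpM2l.
- by exists M => x; apply: (cvg_norm_le _ (hf x)) => n; exact: hM.
Qed.

(** The product formula for cosines makes the trigonometric polynomials an
    algebra, and bounded limits preserve this. *)
Lemma trigM f g : trig_closure f -> trig_closure g ->
  trig_closure (fun x => f x * g x).
Proof.
move=> + Cg; elim=> [theta c|f1 f2 _ C1 _ C2|a f1 _ C1|h f1 M _ Ch hM hf].
- elim: Cg => [eta e|g1 g2 _ C1 _ C2|a g1 _ C1|h g1 M _ Ch hM hg].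
  + rewrite (_ : (fun _ => _) = fun x : k.-tuple R =>
        2^-1 * (cos (\sum_(j < k) (theta + eta) 0 j * tnth x j + (c + e)) +
                cos (\sum_(j < k) (theta - eta) 0 j * tnth x j + (c - e)))).
      by apply: trigZ; apply: trigD; exact: trig_cos.
    apply/funext => x.
    under [in RHS]eq_bigr do rewrite !mxE mulrDl.
    under [X in _ = _ * (_ + cos (X + _))]eq_bigr do rewrite !mxE mulrBl.
    rewrite sumrB big_split/=.
    set a := \sum_(_ < _) _; set b := \sum_(_ < _) _.
    have -> : a + b + (c + e) = (a + c) + (b + e) by ring.
    have -> : a - b + (c - e) = (a + c) - (b + e) by ring.
    by move: (a + c) (b + e) => A B; rewrite cosD cosB; field.
  + by under eq_fun do rewrite mulrDr; exact: trigD.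
  + by under eq_fun do rewrite mulrCA; exact: trigZ.
  + apply: (@trig_lim _ _ M Ch) => [n x|x].
      by rewrite normrM (le_trans _ (hM n x))// ler_piMl// cos_max.
    by apply: cvgM => //; exact: cvg_cst.
- by under eq_fun do rewrite mulrDl; exact: trigD.
- by under eq_fun do rewrite -mulrA; exact: trigZ.
- have [N gN] := trig_closure_bounded Cg.
  apply: (@trig_lim _ _ (M * N) Ch) => [n x|x]; first by rewrite normrM ler_pM.
  by apply: cvgM => //; exact: cvg_cst.
Qed.

Lemma trig_closure_cst c : trig_closure (fun=> c).
Proof.
rewrite (_ : (fun=> c) = fun x : k.-tuple R =>
    c * cos (\sum_(j < k) (0 : 'rV[R]_k) 0 j * tnth x j + 0)).
  by apply: trigZ; exact: trig_cos.
apply/funext => x; rewrite big1 ?addr0 ?cos0 ?mulr1// => j _.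
by rewrite mxE mul0r.
Qed.

Lemma trigX f n : trig_closure f -> trig_closure (fun x => f x ^+ n).
Proof.
move=> Cf; elim: n => [|n IHn].
  by under eq_fun do rewrite expr0; exact: trig_closure_cst.
by under eq_fun do rewrite exprS; exact: trigM.
Qed.

Lemma trig_prod (I : Type) (s : seq I) (F : I -> k.-tuple R -> R) :
  (forall i, trig_closure (F i)) -> trig_closure (fun x => \prod_(i <- s) F i x).
Proof.
move=> CF; elim: s => [|i s IHs].
  by under eq_fun do rewrite big_nil; exact: trig_closure_cst.
by under eq_fun do rewrite big_cons; exact: trigM.
Qed.

(** Powers and bounded limits stay in the class, so that the threshold
    polynomials can be applied to its members. *)
Lemma trig_threshold f : trig_closure f -> (forall x, 0 <= f x <= 1) ->
  trig_closure (fun x => if f x < 1 / 2 then 1 else 0).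
Proof.
move=> Cf f01.
apply: (@trig_lim (fun n x => (1 - f x ^+ n) ^+ (n * 2 ^ n)) _ 1) => [n|n x|x].
- apply: trigX.
  rewrite (_ : (fun _ => _) = fun x => 1 + (- 1) * f x ^+ n).
    apply: trigD; first exact: trig_closure_cst.
    by apply: trigZ; exact: trigX.
  by apply/funext => x; rewrite mulN1r.
- have /andP[f0 f1] := f01 x.
  have := exprn_ge0 n f0; have := exprn_ile1 n f0 f1 => ? ?.
  rewrite ger0_norm; first by apply: exprn_ile1; lra.
  by apply: exprn_ge0; lra.
- exact: threshold_poly_cvg.
Qed.

(** The half-line x_j > a is where sin ((x_j - a) / N) is eventually positive
    as N tends to infinity. *)
Lemma trig_halfline (j : 'I_k) a :
  trig_closure (fun x => if a < tnth x j then 1 else 0).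
Proof.
pose f N (x : k.-tuple R) : R := (1 - sin ((tnth x j - a) / N.+1%:R)) / 2.
apply: (@trig_lim (fun N x => if f N x < 1 / 2 then 1 else 0) _ 1) => [N|N x|x].
- apply: trig_threshold => [|x]; last first.
    have := sin_geN1 ((tnth x j - a) / N.+1%:R).
    by have := sin_le1 ((tnth x j - a) / N.+1%:R); rewrite /f; lra.
  (* The sine is a cosine with phase - pi / 2. *)
  rewrite (_ : f N = fun x : k.-tuple R => 2^-1 + (- 2^-1) *
     cos (\sum_(i < k) (N.+1%:R^-1 *: (delta_mx 0 j : 'rV[R]_k)) 0 i * tnth x i +
          (- (a / N.+1%:R) - pi / 2))).
    apply: trigD; first exact: trig_closure_cst.
    by apply: trigZ; exact: trig_cos.
  apply/funext => x; rewrite (bigD1 j)//= big1 ?addr0; last first.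
    by move=> i ij; rewrite !mxE eqxx (negPf ij) mulr0 mul0r.
  rewrite !mxE !eqxx mulr1 addrA cosBpihalf /f mulrBl [_^-1 * tnth x j]mulrC.
  by rewrite mulNr -[in RHS]mulrBl; ring.
- by case: ifP => _; rewrite ?normr1// normr0.
- apply: cvg_near_cst; have pi0 := @pihalf_ge1 R; near=> N.
  have N0 : 0 < N.+1%:R :> R by [].
  have hN : `|tnth x j - a| < N.+1%:R.
    apply: (@lt_le_trans _ _ N%:R); last by rewrite ler_nat.
    by near: N; exact: nbhs_infty_gtr.
  have : `|(tnth x j - a) / N.+1%:R| < 1.
    by rewrite normrM normfV (gtr0_norm N0) ltr_pdivrMr// mul1r.
  rewrite /f; set y := (tnth x j - a) / N.+1%:R; rewrite ltr_norml => /andP[hl hr].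
  have -> : ((1 - sin y) / 2 < 1 / 2) = (0 < sin y) by apply/idP/idP; lra.
  case: (ltrP a) => ax.
    have y0 : 0 < y by rewrite divr_gt0 ?subr_gt0.
    by rewrite sin_gt0_pihalf// y0 (lt_le_trans hr).
  have y0 : y <= 0 by rewrite /y pmulr_lle0 ?invr_gt0// subr_le0.
  rewrite ltNge -oppr_ge0 -sinN sin_ge0_pi//.
  by rewrite oppr_ge0 y0/=; lra.
Unshelve. all: by end_near. Qed.

End TrigClosure.

(** * Characteristic functions determine laws *)

Section CharFun.
Context {R : realType} d (T : measurableType d) (P : probability T R).

Definition dot k (theta : 'rV[R]_k) (x : k.-tuple R) : R :=
  \sum_(j < k) theta 0 j * tnth x j.

Lemma dotZ k (a : R) (theta : 'rV[R]_k) x : dot (a *: theta) x = a * dot theta x.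
Proof. by rewrite /dot mulr_sumr; apply: eq_bigr => j _; rewrite mxE mulrA. Qed.

Lemma dot0 k x : dot (0 : 'rV[R]_k) x = 0.
Proof. by rewrite -(scale0r 0) dotZ mul0r. Qed.

Lemma dotB k (theta eta : 'rV[R]_k) x : dot theta x - dot eta x = dot (theta - eta) x.
Proof. by rewrite /dot -sumrB; apply: eq_bigr => j _; rewrite !mxE mulrBl. Qed.

Lemma measurable_dot k (theta : 'rV[R]_k) (Z : T -> k.-tuple R) :
  measurable_fun [set: T] Z -> measurable_fun [set: T] (fun w => dot theta (Z w)).
Proof.
move=> /measurable_fun_tnthP mZ; apply: measurable_sum => j.
by apply: measurable_funM => //; exact: mZ.
Qed.

Lemma Re_char_fun k (Z : T -> k.-tuple R) theta :
  complex.Re (char_fun P Z theta) = \int[P]_w cos (dot theta (Z w)).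
Proof.
rewrite /char_fun /cexpectation/=; apply: eq_Rintegral => w _.
by rewrite /cexp/= !(mul0r, mulr0, mul1r, subr0, oppr0, add0r, addr0, expR0).
Qed.

Lemma Im_char_fun k (Z : T -> k.-tuple R) theta :
  complex.Im (char_fun P Z theta) = \int[P]_w sin (dot theta (Z w)).
Proof.
rewrite /char_fun /cexpectation/=; apply: eq_Rintegral => w _.
by rewrite /cexp/= !(mul0r, mulr0, mul1r, subr0, oppr0, add0r, addr0, expR0).
Qed.

Lemma complex_ext (x y : R[i]) : complex.Re x = complex.Re y ->
  complex.Im x = complex.Im y -> x = y.
Proof. by move: x y => [a b] [a' b']/= -> ->. Qed.

Lemma char_funZ k (Z : T -> k.-tuple R) (a : R) theta :
  char_fun P (fun w => [tuple a * tnth (Z w) j | j < k]) theta =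
  char_fun P Z (a *: theta).
Proof.
apply: complex_ext; rewrite ?Re_char_fun ?Im_char_fun; apply: eq_Rintegral => w _;
  congr (_ _); rewrite dotZ /dot mulr_sumr; apply: eq_bigr => j _;
  by rewrite tnth_mktuple mulrCA.
Qed.

End CharFun.

Lemma expect_indic_comp (R : realType) d (T : measurableType d)
    (P : probability T R) d' (T' : measurableType d') (Z : T -> T') A :
  measurable_fun [set: T] Z -> measurable A ->
  \int[P]_w \1_A (Z w) = fine (P (Z @^-1` A)).
Proof.
move=> mZ mA; rewrite -expect_indic; last first.
  by rewrite -[X in measurable X]setTI; exact: mZ.
by apply: eq_Rintegral => w _; rewrite !indicE.
Qed.

Section Laws.
Context {R : realType} d (T : measurableType d) (P : probability T R)
  d' (T' : measurableType d') (P' : probability T' R) (k : nat)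
  (Z : T -> k.-tuple R) (Z' : T' -> k.-tuple R).
Hypotheses (mZ : measurable_fun [set: T] Z) (mZ' : measurable_fun [set: T'] Z').

Lemma same_expect_blc : bounded_limit_closed (fun f : k.-tuple R -> R =>
  bounded_measurable f /\ \int[P]_w f (Z w) = \int[P']_w f (Z' w)).
Proof.
have bZ (f : k.-tuple R -> R) : bounded_measurable f ->
    bounded_measurable (f \o Z) by exact: bounded_measurable_comp.
have bZ' (f : k.-tuple R -> R) : bounded_measurable f ->
    bounded_measurable (f \o Z') by exact: bounded_measurable_comp.
split=> [f g [bf Ef] [bg Eg]|c f [bf Ef]|h f M hV hM hf].
- split; first exact: bounded_measurableD.
  by rewrite (expectD _ (bZ _ bf) (bZ _ bg)) (expectD _ (bZ' _ bf) (bZ' _ bg)) Ef Eg.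
- split; first exact: bounded_measurableZ.
  by rewrite (expectZ _ _ (bZ _ bf)) (expectZ _ _ (bZ' _ bf)) Ef.
- have mh n : measurable_fun [set: k.-tuple R] (h n) by have [[]] := hV n.
  split; first exact: bounded_measurable_lim mh hM hf.
  have cZ : \int[P]_w h n (Z w) @[n --> \oo] --> \int[P]_w f (Z w).
    apply: (@expect_cvg _ _ _ _ (fun n => h n \o Z) (f \o Z) M) => [n|n w|w].
    - exact: measurableT_comp.
    - exact: hM.
    - exact: hf.
  have cZ' : \int[P']_w h n (Z' w) @[n --> \oo] --> \int[P']_w f (Z' w).
    apply: (@expect_cvg _ _ _ _ (fun n => h n \o Z') (f \o Z') M) => [n|n w|w].
    - exact: measurableT_comp.
    - exact: hM.
    - exact: hf.
  have E : (fun n => \int[P]_w h n (Z w)) = (fun n => \int[P']_w h n (Z' w)).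
    by apply/funext => n; have [] := hV n.
  by rewrite E in cZ; exact: cvg_unique cZ cZ'.
Qed.

Lemma same_law_expect : same_law P P' Z Z' ->
  forall f : k.-tuple R -> R, bounded_measurable f ->
  \int[P]_w f (Z w) = \int[P']_w f (Z' w).
Proof.
move=> ZZ' f bf.
suff [] : bounded_measurable f /\ \int[P]_w f (Z w) = \int[P']_w f (Z' w) by [].
apply: (blc_bounded_measurable same_expect_blc) bf => A mA; split.
  exact: bounded_measurable_indic.
by rewrite !expect_indic_comp// ZZ'.
Qed.

Lemma same_law_char_fun : same_law P P' Z Z' -> char_fun P Z = char_fun P' Z'.
Proof.
move=> /same_law_expect ZZ'; apply/funext => theta.
have md : measurable_fun [set: k.-tuple R] (dot theta).
  exact: (measurable_dot _ (Z := id)).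
apply: complex_ext; rewrite ?Re_char_fun ?Im_char_fun.
- by apply: (ZZ' (cos \o dot theta)); exact: bounded_measurable_cos.
- by apply: (ZZ' (sin \o dot theta)); exact: bounded_measurable_sin.
Qed.

(** The characteristic functions give the expectations of the cosines, and the
    class of functions with equal expectations is closed under all constructors
    of trig_closure. *)
Lemma trig_closure_expect : char_fun P Z = char_fun P' Z' ->
  forall f, trig_closure f ->
  bounded_measurable f /\ \int[P]_w f (Z w) = \int[P']_w f (Z' w).
Proof.
move=> ZZ' f; elim=> {f} [theta c|f g _ Vf _ Vg|c f _ Vf|h f M _ Vh hM hf].
- have md : measurable_fun [set: k.-tuple R] (dot theta).
    exact: (measurable_dot _ (Z := id)).
  split; first by apply: bounded_measurable_cos; exact: measurable_funD.
  have E d0 (T0 : measurableType d0) (P0 : probability T0 R)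
      (Z0 : T0 -> k.-tuple R) : measurable_fun [set: T0] Z0 ->
      \int[P0]_w cos (dot theta (Z0 w) + c) =
      cos c * complex.Re (char_fun P0 Z0 theta) -
      sin c * complex.Im (char_fun P0 Z0 theta).
    move=> mZ0; have mdZ := measurable_dot theta mZ0.
    rewrite Re_char_fun Im_char_fun.
    rewrite -(expectZ _ _ (bounded_measurable_cos mdZ)).
    rewrite -(expectZ _ _ (bounded_measurable_sin mdZ)) -expectB.
    + by apply: eq_Rintegral => w _; rewrite cosD mulrC [sin c * _]mulrC.
    + by apply: bounded_measurableZ; exact: bounded_measurable_cos.
    + by apply: bounded_measurableZ; exact: bounded_measurable_sin.
  by rewrite (E _ _ P Z mZ) (E _ _ P' Z' mZ') ZZ'.
- exact: (blcD same_expect_blc).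
- exact: (blcZ same_expect_blc).
- exact: (blc_lim same_expect_blc Vh hM hf).
Qed.

End Laws.

Section Boxes.
Context {R : realType} (k : nat).

(** The value -oo leaves a coordinate unconstrained, so that the boxes form a
    pi-system that contains the whole space. *)
Definition upper_box (a : 'I_k -> \bar R) : set (k.-tuple R) :=
  [set x | forall j, (a j < (tnth x j)%:E)%E].

Lemma upper_boxI a b :
  upper_box a `&` upper_box b = upper_box (fun j => maxe (a j) (b j)).
Proof.
apply/seteqP; split=> [x [ax bx] j|x abx]; first by rewrite gt_max ax bx.
by split=> j; have := abx j; rewrite gt_max => /andP[].
Qed.

Lemma trig_upper_box a : trig_closure (\1_(upper_box a) : k.-tuple R -> R).
Proof.
rewrite (_ : \1_ _ = fun x : k.-tuple R =>
    \prod_(j <- index_enum 'I_k) (if (a j < (tnth x j)%:E)%E then 1 else 0)).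
  apply: trig_prod => j; case: (a j) => [c||].
  - by under eq_fun do rewrite lte_fin; exact: trig_halfline.
  - exact: trig_closure_cst.
  - by under eq_fun do rewrite ltNyr; exact: trig_closure_cst.
apply/funext => x; rewrite indicE; have [xa|xa] := boolP (_ \in _).
  by rewrite big1// => j _; move: xa; rewrite inE => /(_ j) ->.
have /existsP[j jx] : [exists j, ~~ (a j < (tnth x j)%:E)%E].
  rewrite -negb_forall; apply: contra xa => /forallP xa.
  by rewrite inE => j; exact: xa.
by rewrite (bigD1 j)//= (negPf jx) mul0r.
Qed.

Lemma measurable_upper_box a : measurable (upper_box a).
Proof.
have -> : upper_box a = \bigcap_(j in [set: 'I_k])
    ((fun x : k.-tuple R => tnth x j) @^-1` [set r | (a j < r%:E)%E]).
  by apply/seteqP; split=> [x xa j _|x xa j]; [exact: xa|exact: (xa j)].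
apply: fin_bigcap_measurable => // j _; rewrite -[X in measurable X]setTI.
apply: measurable_tnth => //; case: (a j) => [c||].
- rewrite (_ : [set _ | _] = `]c, +oo[%classic)//.
  by apply/seteqP; split=> r /=; rewrite lte_fin in_itv/= andbT.
- by rewrite (_ : [set _ | _] = set0)//; apply/seteqP; split.
- by rewrite (_ : [set _ | _] = setT)//; apply/seteqP; split => // r _; exact: ltNyr.
Qed.

Lemma measurable_tuple_upper_box :
  @measurable _ (k.-tuple R) = <<s range upper_box >>.
Proof.
apply/seteqP; split; last first.
  apply: smallest_sub; first exact: sigma_algebra_measurable.
  by move=> _ [a _ <-]; exact: measurable_upper_box.
move=> A mA.
have mid : measurable_fun [set: g_sigma_algebraType (range upper_box)]
    (fun x => (x : k.-tuple R)).
  apply/measurable_fun_tnthP => j.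
  apply: (measurability _ (RGenOInfty.measurableE R)) => _ [_ [c ->] <-].
  rewrite setTI; apply: sub_sigma_algebra.
  exists (fun i => if i == j then c%:E else -oo%E) => //.
  apply/seteqP; split=> x /=.
    by move=> /(_ j); rewrite eqxx lte_fin in_itv/= andbT.
  rewrite in_itv/= andbT => cx i; case: eqP => [->|_]; first by rewrite lte_fin.
  by rewrite ltNyr.
by have := mid measurableT A mA; rewrite setTI.
Qed.

End Boxes.

(** The expectations agree on trig_closure, hence on the indicators of the upper
    boxes, and these form a generating pi-system. *)
Theorem char_fun_inj (R : realType) d (T : measurableType d)
    (P : probability T R) d' (T' : measurableType d') (P' : probability T' R)
    (k : nat) (Z : T -> k.-tuple R) (Z' : T' -> k.-tuple R) :
  measurable_fun [set: T] Z -> measurable_fun [set: T'] Z' ->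
  char_fun P Z = char_fun P' Z' -> same_law P P' Z Z'.
Proof.
move=> mZ mZ' ZZ' B mB.
pose rZ : {mfun T >-> k.-tuple R} := HB.pack Z (isMeasurableFun.Build _ _ _ _ Z mZ).
pose rZ' : {mfun T' >-> k.-tuple R} :=
  HB.pack Z' (isMeasurableFun.Build _ _ _ _ Z' mZ').
suff : distribution P rZ B = distribution P' rZ' B by [].
apply: (@measure_unique _ _ _ (range (@upper_box R k))
  (fun=> upper_box (fun=> -oo%E)) (measurable_tuple_upper_box k)) => //.
- by move=> _ _ [a _ <-] [b _ <-]; rewrite upper_boxI; exists (fun j => maxe (a j) (b j)).
- by apply/seteqP; split => // x _; exists 0%N => // j; rewrite ltNyr.
- move=> _ [a _ <-].
  rewrite -[LHS]/(P (Z @^-1` upper_box a)) -[RHS]/(P' (Z' @^-1` upper_box a)).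
  have mE d0 (T0 : measurableType d0) (P0 : probability T0 R)
      (Z0 : T0 -> k.-tuple R) : measurable_fun [set: T0] Z0 ->
      (P0 (Z0 @^-1` upper_box a) = (\int[P0]_w \1_(upper_box a) (Z0 w))%:E)%E.
    move=> mZ0; have mB' := measurable_upper_box a.
    rewrite expect_indic_comp// fineK// fin_num_measure//.
    by rewrite -[X in measurable X]setTI; exact: mZ0.
  rewrite (mE _ _ P Z mZ) (mE _ _ P' Z' mZ'); congr (_%:E).
  by have [] := trig_closure_expect mZ mZ' ZZ' (trig_upper_box a).
- by move=> _; rewrite (le_lt_trans (probability_le1 _ _)) ?ltry//; exact: measurable_upper_box.
Qed.

(** * Sums of independent vectors *)

Section IndependentSum.
Context {R : realType} d (T : measurableType d) (P : probability T R).

(** This is applied with W a function of variables independent of Y, times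
    indicators of events that concern further variables. *)
Lemma expectM_of_events d' (T' : measurableType d') (Y : T -> T') (W : T -> R) kappa :
  measurable_fun [set: T] Y -> bounded_measurable W ->
  (forall B, measurable B ->
     \int[P]_w (W w * \1_B (Y w)) = kappa * fine (P (Y @^-1` B))) ->
  forall f : T' -> R, bounded_measurable f ->
  \int[P]_w (W w * f (Y w)) = kappa * \int[P]_w f (Y w).
Proof.
move=> mY bW WB f bf.
have bY (g : T' -> R) : bounded_measurable g -> bounded_measurable (g \o Y).
  exact: bounded_measurable_comp.
suff [] : bounded_measurable f /\
  \int[P]_w (W w * f (Y w)) = kappa * \int[P]_w f (Y w) by [].
move: f bf; apply: blc_bounded_measurable => [|B mB]; last first.
  split; first exact: bounded_measurable_indic.
  by rewrite WB// expect_indic_comp.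
have bWY (g : T' -> R) : bounded_measurable g ->
    bounded_measurable (fun w => W w * g (Y w)).
  by move=> bg; apply: bounded_measurableM => //; exact: bY.
split=> [f g [bf Ef] [bg Eg]|c f [bf Ef]|h f M hV hM hf].
- split; first exact: bounded_measurableD.
  under eq_Rintegral do rewrite mulrDr.
  rewrite (expectD _ (bWY _ bf) (bWY _ bg)) (expectD _ (bY _ bf) (bY _ bg)).
  by rewrite Ef Eg mulrDr.
- split; first exact: bounded_measurableZ.
  under eq_Rintegral do rewrite mulrCA.
  by rewrite (expectZ _ _ (bWY _ bf)) (expectZ _ _ (bY _ bf)) Ef mulrCA.
- have mh n : measurable_fun [set: T'] (h n) by have [[]] := hV n.
  split; first exact: bounded_measurable_lim mh hM hf.
  have [mW [N WN]] := bW.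
  have cW : \int[P]_w (W w * h n (Y w)) @[n --> \oo] --> \int[P]_w (W w * f (Y w)).
    apply: (@expect_cvg _ _ _ _ (fun n w => W w * h n (Y w)) _ (N * M)) => [n|n w|w].
    - by apply: measurable_funM => //; exact: measurableT_comp.
    - by rewrite normrM ler_pM.
    - by apply: cvgMl_tmp; exact: hf.
  have cY : kappa * \int[P]_w h n (Y w) @[n --> \oo] --> kappa * \int[P]_w f (Y w).
    apply: cvgMl_tmp; apply: (@expect_cvg _ _ _ _ (fun n w => h n (Y w)) _ M) => [n|n w|w].
    - exact: measurableT_comp.
    - exact: hM.
    - exact: hf.
  have E : (fun n => \int[P]_w (W w * h n (Y w))) =
           (fun n => kappa * \int[P]_w h n (Y w)).
    by apply/funext => n; have [] := hV n.
  by rewrite E in cW; exact: cvg_unique cW cY.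
Qed.

Context (m k : nat) (Y : 'I_m -> T -> k.-tuple R).
Hypotheses (mY : forall i, measurable_fun [set: T] (Y i))
  (iY : independent_vectors P Y).

Let pr i (B : set (k.-tuple R)) := fine (P (Y i @^-1` B)).

Lemma expect_prod_indic (B : 'I_m -> set (k.-tuple R)) :
  (forall i, measurable (B i)) ->
  \int[P]_w (\prod_i \1_(B i) (Y i w)) = \prod_i pr i (B i).
Proof.
move=> mB; have mYB i : measurable (Y i @^-1` B i).
  by rewrite -[X in measurable X]setTI; exact: mY.
under eq_Rintegral => w _.
  rewrite (_ : \prod_i _ = \1_(\bigcap_(i in [set: 'I_m]) Y i @^-1` B i) w).
    over.
  rewrite indicE; have [wB|wB] := boolP (w \in _).
    by rewrite big1// => i _; rewrite indicE mem_set//; move: wB; rewrite inE; exact.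
  have /existsP[i iB] : [exists i, Y i w \notin B i].
    rewrite -negb_forall; apply: contra wB => /forallP wB.
    by rewrite inE => i _; have := wB i; rewrite inE.
  by rewrite (bigD1 i)//= indicE (negPf iB) mul0r.
rewrite expect_indic; last by apply: fin_bigcap_measurable => // i _.
rewrite iY; last by move=> i; exists (B i) => //; rewrite setTI.
rewrite (eq_bigr (fun i => (pr i (B i))%:E)) ?prodEFin// => i _.
by rewrite fineK// fin_num_measure.
Qed.

Context (theta : 'rV[R]_k).
Let U i w := dot theta (Y i w).
Let S r w := \sum_(i < m | (i < r)%N) U i w.
Let Phi r := \prod_(i < m | (i < r)%N) char_fun P (Y i) theta.
Let tail r (B : 'I_m -> set (k.-tuple R)) w : R :=
  \prod_(i < m | (r <= i)%N) \1_(B i) (Y i w).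
Let ptail r (B : 'I_m -> set (k.-tuple R)) := \prod_(i < m | (r <= i)%N) pr i (B i).

Let mU i : measurable_fun [set: T] (U i).
Proof. exact: measurable_dot. Qed.

Let mS r : measurable_fun [set: T] (S r).
Proof.
rewrite /S; under eq_fun do rewrite -big_filter.
by apply: measurable_sum => i; exact: mU.
Qed.

Let btail r B : (forall i, measurable (B i)) -> bounded_measurable (tail r B).
Proof.
move=> mB; apply: bounded_measurable_prod => i.
by apply: (bounded_measurable_comp (mY i)); exact: bounded_measurable_indic.
Qed.

(** Induction on r, the number of factors in which an indicator has been replaced
    by the exponential of i U_j. Keeping indicators in the other factors avoids
    showing that partial sums are independent of the remaining variables. *)
Let expect_partial r : (r <= m)%N -> forall B, (forall i, measurable (B i)) ->
  \int[P]_w (cos (S r w) * tail r B w) = complex.Re (Phi r) * ptail r B /\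
  \int[P]_w (sin (S r w) * tail r B w) = complex.Im (Phi r) * ptail r B.
Proof.
elim: r => [_|r IHr rm] B mB.
  have S0 w : S 0 w = 0 by rewrite /S big_pred0.
  rewrite /Phi big_pred0//= mul1r mul0r; split.
    under eq_Rintegral do rewrite S0 cos0 mul1r.
    exact: expect_prod_indic.
  under eq_Rintegral do rewrite S0 sin0 mul0r.
  exact: expect_cst.
set o := Ordinal rm.
have ltS (i : 'I_m) : (i < r.+1)%N && (i != o) = (i < r)%N.
  by rewrite ltnS [(i < r)%N]ltn_neqAle -val_eqE/= andbC.
have geS (i : 'I_m) : (r <= i)%N && (i != o) = (r < i)%N.
  by rewrite -val_eqE/= ltn_neqAle eq_sym andbC.
have SS w : S r.+1 w = S r w + U o w.
  by rewrite /S (bigD1 o)//= addrC; congr (_ + _); apply: eq_bigl => i; exact: ltS.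
have PhiS : Phi r.+1 = Phi r * char_fun P (Y o) theta.
  by rewrite /Phi (bigD1 o)//= mulrC; congr (_ * _); apply: eq_bigl => i; exact: ltS.
have step (W : T -> R) kappa : bounded_measurable W ->
    (forall B, (forall i, measurable (B i)) ->
       \int[P]_w (W w * tail r B w) = kappa * ptail r B) ->
    forall f : k.-tuple R -> R, bounded_measurable f ->
    \int[P]_w (W w * tail r.+1 B w * f (Y o w)) =
    kappa * ptail r.+1 B * \int[P]_w f (Y o w).
  move=> bW WB; apply: expectM_of_events => //.
    by apply: bounded_measurableM => //; exact: btail.
  move=> C mC; pose BC i := if i == o then C else B i.
  have mBC i : measurable (BC i) by rewrite /BC; case: ifP.
  have -> : kappa * ptail r.+1 B * fine (P (Y o @^-1` C)) = kappa * ptail r BC.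
    rewrite -mulrA; congr (_ * _); rewrite /ptail [RHS](bigD1 o)//= mulrC.
    rewrite /BC eqxx; congr (_ * _); apply: eq_big => [i|i ri]; first exact/esym/geS.
    by rewrite ifF//; apply/negbTE; have := ri; rewrite -geS => /andP[].
  rewrite -(WB _ mBC); apply: eq_Rintegral => w _.
  rewrite -mulrA; congr (_ * _); rewrite /tail [RHS](bigD1 o)//= mulrC.
  rewrite /BC eqxx; congr (_ * _); apply: eq_big => [i|i ri]; first exact/esym/geS.
  by rewrite ifF//; apply/negbTE; have := ri; rewrite -geS => /andP[].
have bcS : bounded_measurable (fun w => cos (S r w)).
  exact: (bounded_measurable_cos (mS r)).
have bsS : bounded_measurable (fun w => sin (S r w)).
  exact: (bounded_measurable_sin (mS r)).
have mdot : measurable_fun [set: k.-tuple R] (dot theta).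
  exact: (measurable_dot _ (Z := id)).
have bc := bounded_measurable_cos mdot; have bs := bounded_measurable_sin mdot.
have Hc := step _ _ bcS (fun B mB => (IHr (ltnW rm) B mB).1).
have Hs := step _ _ bsS (fun B mB => (IHr (ltnW rm) B mB).2).
have bT (g h : T -> R) : bounded_measurable g -> bounded_measurable h ->
    bounded_measurable (fun w => g w * tail r.+1 B w * h w).
  move=> bg bh; apply: bounded_measurableM => //.
  by apply: bounded_measurableM => //; exact: btail.
have bcU : bounded_measurable (fun w => cos (U o w)) by exact: bounded_measurable_cos.
have bsU : bounded_measurable (fun w => sin (U o w)) by exact: bounded_measurable_sin.
have ReM (x y : R[i]) : complex.Re (x * y) =
    complex.Re x * complex.Re y - complex.Im x * complex.Im y.
  by case: x; case: y.
have ImM (x y : R[i]) : complex.Im (x * y) =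
    complex.Re x * complex.Im y + complex.Im x * complex.Re y.
  by case: x; case: y.
rewrite PhiS ReM ImM Re_char_fun Im_char_fun; split.
- rewrite (_ : _ * _ = complex.Re (Phi r) * ptail r.+1 B * \int[P]_w cos (U o w) -
    complex.Im (Phi r) * ptail r.+1 B * \int[P]_w sin (U o w)); last by ring.
  rewrite -(Hc _ bc) -(Hs _ bs) -expectB; [|exact: bT|exact: bT].
  by apply: eq_Rintegral => w _; rewrite SS cosD /U; ring.
- rewrite (_ : _ * _ = complex.Re (Phi r) * ptail r.+1 B * \int[P]_w sin (U o w) +
    complex.Im (Phi r) * ptail r.+1 B * \int[P]_w cos (U o w)); last by ring.
  rewrite -(Hc _ bs) -(Hs _ bc) -expectD; [|exact: bT|exact: bT].
  by apply: eq_Rintegral => w _; rewrite SS sinD /U; ring.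
Qed.

Theorem char_fun_sum :
  char_fun P (fun w => [tuple \sum_(i < m) tnth (Y i w) j | j < k]) theta =
  \prod_(i < m) char_fun P (Y i) theta.
Proof.
have [] := @expect_partial m (leqnn m) (fun=> setT) (fun=> measurableT).
have lem (i : 'I_m) : (m <= i)%N = false by apply/negbTE; rewrite -ltnNge.
have -> : ptail m (fun=> setT) = 1 by rewrite /ptail big_pred0.
have tail1 w : tail m (fun=> setT) w = 1 by rewrite /tail big_pred0.
have -> : Phi m = \prod_(i < m) char_fun P (Y i) theta.
  by apply: eq_bigl => i; rewrite ltn_ord.
have Sm w : S m w = dot theta [tuple \sum_(i < m) tnth (Y i w) j | j < k].
  rewrite /S /dot; under [RHS]eq_bigr do rewrite tnth_mktuple mulr_sumr.
  by rewrite [RHS]exchange_big/=; apply: eq_bigl => i; rewrite ltn_ord.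
rewrite !mulr1 => Hc Hs.
apply: complex_ext; [rewrite Re_char_fun -Hc|rewrite Im_char_fun -Hs];
  by apply: eq_Rintegral => w _; rewrite tail1 mulr1 Sm.
Qed.

End IndependentSum.

(** * Existence of independent copies *)

Lemma measurable_fd_vector (R : realType) d (T : measurableType d)
    (Y : R -> T -> R) k (t : 'I_k -> R) :
  (forall j, measurable_fun [set: T] (Y (t j))) ->
  measurable_fun [set: T] (fd_vector Y t).
Proof.
move=> mY; apply/measurable_fun_tnthP => j.
by rewrite (_ : _ \o _ = Y (t j))//; apply/funext => w /=; rewrite tnth_mktuple.
Qed.

Section IndependentCopies.
Context {R : realType}.

Lemma independent_coordinates d (T : measurableType d) (P : probability T R) m :
  exists (d' : measure_display) (T' : measurableType d') (P' : probability T' R)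
    (pi_ : 'I_m -> T' -> T), (forall i, measurable_fun [set: T'] (pi_ i)) /\
    forall A : 'I_m -> set T, (forall i, measurable (A i)) ->
      P' (\bigcap_i pi_ i @^-1` A i) = (\prod_i P (A i))%E.
Proof.
elim: m => [|m [d' [T' [P' [pi_ [mpi ipi]]]]]].
  exists d, T, P, (fun _ x => x); split => // A _; rewrite big_ord0.
  rewrite (_ : \bigcap_i _ = setT) ?probability_setT//.
  by apply/seteqP; split => // x _ [].
have PP1 : (P \x P')%E [set: T * T'] = 1%E.
  rewrite -setXTT; transitivity (P setT * P' setT)%E.
    exact: product_measure1E.
  by rewrite !probability_setT mule1.
pose PP : probability (T * T')%type R :=
  HB.pack (P \x P')%E (Measure_isProbability.Build _ _ _ (P \x P')%E PP1).
exists _, (T * T')%type, PP,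
  (fun i x => if unlift ord0 i is Some j then pi_ j x.2 else x.1).
split=> [i|A mA].
  by case: unliftP => [j _|_] //; exact: measurableT_comp.
rewrite (_ : \bigcap_i _ = A ord0 `*` \bigcap_j pi_ j @^-1` A (lift ord0 j)).
  rewrite big_ord_recl -ipi//; apply: product_measure1E => //.
  apply: fin_bigcap_measurable => // j _.
  by rewrite -[X in measurable X]setTI; exact: mpi.
apply/seteqP; split=> [x xA|x [x0 xA] i _].
  split; first by have := xA ord0 I; rewrite /= unlift_none.
  by move=> j _; have := xA (lift ord0 j) I; rewrite /= liftK.
by rewrite /=; case: unliftP => [j ->|->//]; exact: xA.
Qed.

Lemma process_sigma_comp (T' : Type) d (TM : measurableType d) (TT : set R)
    (X : R -> TM -> R) (phi : T' -> TM) :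
  (forall t, TT t -> measurable_fun [set: TM] (X t)) ->
  process_sigma TT (fun t w => X t (phi w)) `<=`
  preimage_set_system [set: T'] phi measurable.
Proof.
move=> mX; apply: smallest_sub.
  by apply: sigma_algebra_preimage; exact: sigma_algebra_measurable.
move=> _ [t Tt [B mB <-]]; exists (X t @^-1` B).
  by rewrite -[X in measurable X]setTI; exact: mX.
by rewrite !setTI.
Qed.

Lemma independent_process_copies d (T : measurableType d) (P : probability T R)
    (TT : set R) (X : R -> T -> R) m : stochastic_process TT X ->
  exists (d' : measure_display) (T' : measurableType d') (P' : probability T' R)
    (Y : 'I_m -> R -> T' -> R), [/\ forall i, stochastic_process TT (Y i),
    independent_processes P' TT Y & forall i, same_fdd P' P TT (Y i) X].
Proof.
move=> mX; have [d' [T' [P' [pi_ [mpi ipi]]]]] := independent_coordinates P m.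
have marginal i A : measurable A -> P' (pi_ i @^-1` A) = P A.
  move=> mA; pose B j := if j == i then A else setT.
  have mB j : measurable (B j) by rewrite /B; case: ifP.
  have Bi : B i = A by rewrite /B eqxx.
  have := ipi B mB; rewrite (bigD1 i)//= big1 => [|j /negPf ji]; last first.
    by rewrite /B ji probability_setT.
  rewrite Bi mule1 => <-.
  congr (P' _); apply/seteqP; split=> [x xA j _|x /(_ i I)].
    by rewrite /B/=; case: eqP => // ->.
  by rewrite /= Bi.
exists d', T', P', (fun i t w => X t (pi_ i w)); split.
- by move=> i t Tt; apply: measurableT_comp => //; exact: mX.
- move=> A FA; have {}FA i : exists B, measurable B /\ pi_ i @^-1` B = A i.
    have [B mB <-] := process_sigma_comp mX (FA i).
    by exists B; rewrite setTI.
  have [B HB] := choice FA.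
  rewrite (_ : \bigcap_i A i = \bigcap_i pi_ i @^-1` B i); last first.
    by apply: eq_bigcapr => i _; have [] := HB i.
  rewrite ipi => [|i]; last by have [] := HB i.
  by apply: eq_bigr => i _; have [mB <-] := HB i; rewrite marginal.
- move=> i k t k0 Tt C mC; apply: (marginal i (fd_vector X t @^-1` C)).
  rewrite -[X in measurable X]setTI; have : measurable_fun [set: T] (fd_vector X t).
    by apply: measurable_fd_vector => j; exact: mX.
  exact.
Qed.

End IndependentCopies.

(** * Modulus of continuity of a characteristic function *)

Section Lipschitz.
Context {R : realType}.

Lemma lipschitz1_of_derive (f df : R -> R) :
  (forall x : R, is_derive x 1 f (df x)) -> (forall x, `|df x| <= 1) ->
  forall x y, `|f x - f y| <= `|x - y|.
Proof.
move=> fdf df1 x y; wlog xy : x y / y <= x.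
  by move=> H; have [/H//|/ltW/H] := leP y x; rewrite distrC [in leRHS]distrC.
have cf : {within `[y, x], continuous f}.
  apply: continuous_subspaceT => z; apply: differentiable_continuous.
  by apply/derivable1_diffP; have [] := fdf z.
have [c _ ->] := MVT_segment xy (fun z _ => fdf z) cf.
by rewrite normrM ler_piMl.
Qed.

Lemma cos_lipschitz (x y : R) : `|cos x - cos y| <= Num.min 2 `|x - y|.
Proof.
rewrite le_min; apply/andP; split.
  by rewrite (le_trans (ler_normB _ _))//; have := cos_max x; have := cos_max y; lra.
apply: (lipschitz1_of_derive (df := fun x => - sin x)) => z.
by rewrite normrN sin_max.
Qed.

Lemma sin_lipschitz (x y : R) : `|sin x - sin y| <= Num.min 2 `|x - y|.
Proof.
rewrite le_min; apply/andP; split.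
  by rewrite (le_trans (ler_normB _ _))//; have := sin_max x; have := sin_max y; lra.
apply: (lipschitz1_of_derive (df := cos)) => z.
exact: cos_max.
Qed.

End Lipschitz.

Lemma continuous_of_dist (R : realType) (V : normedModType R) (f : V -> R) :
  (forall x e, 0 < e -> exists2 h, 0 < h &
     forall y, `|x - y| <= h -> `|f x - f y| < e) -> continuous f.
Proof.
move=> H x; apply/cvgrPdist_lt => e e0; have [h h0 xh] := H x e e0.
by apply/nbhs_normP; exists h => //= y /ltW; exact: xh.
Qed.

Section Modulus.
Context {R : realType} d (T : measurableType d) (P : probability T R) (k : nat).
Implicit Type Z : T -> k.-tuple R.

Definition norm1 (x : k.-tuple R) : R := \sum_(j < k) `|tnth x j|.

Lemma norm1_ge0 x : 0 <= norm1 x. Proof. exact: sumr_ge0. Qed.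

Lemma norm_coord_le (theta : 'rV[R]_k) j : `|theta 0 j| <= `|theta|.
Proof.
rewrite [leRHS]mx_normrE.
exact: (le_bigmax 0 (fun ij => `|theta ij.1 ij.2|) (0, j)).
Qed.

Lemma norm_dot_le (theta : 'rV[R]_k) x : `|dot theta x| <= `|theta| * norm1 x.
Proof.
rewrite /dot /norm1 mulr_sumr (le_trans (ler_norm_sum _ _ _))//.
by apply: ler_sum => j _; rewrite normrM ler_wpM2r// norm_coord_le.
Qed.

Lemma min2_norm1_ge0 (h : R) x : 0 <= h -> 0 <= Num.min 2 (h * norm1 x).
Proof. by move=> h0; rewrite le_min ler0n mulr_ge0 ?norm1_ge0. Qed.

Lemma min2_norm1_le (h : R) x : 0 <= h -> `|Num.min 2 (h * norm1 x)| <= 2.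
Proof. by move=> h0; rewrite ger0_norm ?min2_norm1_ge0// ge_min lexx. Qed.

(** A bound for the oscillation of the characteristic function of Z at scale h.
    It tends to 0 with h, and truncation at 2 makes it the expectation of
    a bounded continuous function of Z, so that for fixed h it is continuous
    with respect to convergence in distribution. *)
Definition osc Z (h : R) : R := \int[P]_w Num.min 2 (h * norm1 (Z w)).

Lemma measurable_norm1 Z : measurable_fun [set: T] Z ->
  measurable_fun [set: T] (norm1 \o Z).
Proof.
move=> /measurable_fun_tnthP mZ; apply: measurable_sum => j.
by apply: measurableT_comp => //; exact: mZ.
Qed.

Lemma bounded_measurable_osc Z h : measurable_fun [set: T] Z -> 0 <= h ->
  bounded_measurable (fun w => Num.min 2 (h * norm1 (Z w))).
Proof.
move=> mZ h0; split.
  apply: measurable_minr => //; apply: measurable_funM => //.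
  exact: measurable_norm1.
by exists 2 => w; exact: min2_norm1_le.
Qed.

Lemma osc_ge0 Z h : 0 <= h -> 0 <= osc Z h.
Proof.
by move=> h0; apply: Rintegral_ge0 => w _; exact: min2_norm1_ge0.
Qed.

Lemma osc_cvg0 Z : measurable_fun [set: T] Z ->
  forall e, 0 < e -> exists2 h, 0 < h & osc Z h < e.
Proof.
move=> mZ e e0.
have c : osc Z n.+1%:R^-1 @[n --> \oo] --> \int[P]_w (0 : R).
  apply: (@expect_cvg _ _ _ P (fun n w => Num.min 2 (n.+1%:R^-1 * norm1 (Z w))) _ 2).
  - by move=> n; have [] := bounded_measurable_osc (h := n.+1%:R^-1) mZ.
  - by move=> n w; exact: min2_norm1_le.
  - move=> w; apply: (@squeeze_cvgr _ _ _ _ (fun=> 0)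
      (fun n => n.+1%:R^-1 * norm1 (Z w))).
    + by near=> n; rewrite min2_norm1_ge0//= ge_min lexx orbT.
    + exact: cvg_cst.
    + rewrite -[X in _ --> X](mul0r (norm1 (Z w))); apply: cvgMr_tmp.
      exact: cvg_harmonic.
rewrite expect_cst in c.
move/cvgrPdist_lt : c => /(_ _ e0) [n _ /(_ n (leqnn n))]/=.
rewrite sub0r normrN ger0_norm ?osc_ge0// => on.
by exists n.+1%:R^-1.
Unshelve. all: by end_near. Qed.

Lemma char_fun_osc Z (theta eta : 'rV[R]_k) h : measurable_fun [set: T] Z ->
  `|theta - eta| <= h ->
  `|complex.Re (char_fun P Z theta) - complex.Re (char_fun P Z eta)| <= osc Z h /\
  `|complex.Im (char_fun P Z theta) - complex.Im (char_fun P Z eta)| <= osc Z h.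
Proof.
move=> mZ te; have h0 : 0 <= h by exact: le_trans te.
have md (a : 'rV[R]_k) : measurable_fun [set: T] (fun w => dot a (Z w)).
  exact: measurable_dot.
have bo := bounded_measurable_osc mZ h0.
have le w : Num.min 2 `|dot theta (Z w) - dot eta (Z w)| <=
            Num.min 2 (h * norm1 (Z w)).
  rewrite le_min ge_min lexx/= ge_min; apply/orP; right.
  by rewrite dotB (le_trans (norm_dot_le _ _))// ler_wpM2r ?norm1_ge0.
rewrite !Re_char_fun !Im_char_fun.
have bc (a : 'rV[R]_k) := bounded_measurable_cos (md a).
have bs (a : 'rV[R]_k) := bounded_measurable_sin (md a).
split; rewrite -expectB//; apply: norm_expect_le => //.
- exact: bounded_measurableB.
- by move=> w; apply: (le_trans (cos_lipschitz _ _)).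
- exact: bounded_measurableB.
- by move=> w; apply: (le_trans (sin_lipschitz _ _)).
Qed.

Lemma char_fun0 Z : char_fun P Z 0 = 1.
Proof.
apply: complex_ext; rewrite ?Re_char_fun ?Im_char_fun.
- by under eq_Rintegral do rewrite dot0 cos0; exact: expect_cst.
- by under eq_Rintegral do rewrite dot0 sin0; exact: expect_cst.
Qed.

Lemma char_fun_le1 Z theta : measurable_fun [set: T] Z ->
  `|complex.Re (char_fun P Z theta)| <= 1 /\ `|complex.Im (char_fun P Z theta)| <= 1.
Proof.
move=> mZ; have md : measurable_fun [set: T] (fun w => dot theta (Z w)).
  exact: measurable_dot.
rewrite Re_char_fun Im_char_fun -(expect_cst P 1).
split; apply: norm_expect_le.
- exact: bounded_measurable_cos.
- exact: bounded_measurable_cst.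
- by move=> w; exact: cos_max.
- exact: bounded_measurable_sin.
- exact: bounded_measurable_cst.
- by move=> w; exact: sin_max.
Qed.

Lemma char_fun_continuous Z : measurable_fun [set: T] Z ->
  continuous (fun theta : 'rV[R]_k => complex.Re (char_fun P Z theta)) /\
  continuous (fun theta : 'rV[R]_k => complex.Im (char_fun P Z theta)).
Proof.
move=> mZ; split; apply: continuous_of_dist => theta e e0;
  have [h h0 oh] := osc_cvg0 mZ e0; exists h => // eta te;
  by apply: le_lt_trans oh; have [] := char_fun_osc mZ te.
Qed.

End Modulus.

(** * Infinitely divisible characteristic functions do not vanish *)

Section NonVanishing.
Context {R : realType}.

Definition sqmod (z : R[i]) : R := complex.Re z ^+ 2 + complex.Im z ^+ 2.

Lemma sqmodM z z' : sqmod (z * z') = sqmod z * sqmod z'.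
Proof. by case: z => a b; case: z' => a' b'; rewrite /sqmod/=; ring. Qed.

Lemma sqmodX z n : sqmod (z ^+ n) = sqmod z ^+ n.
Proof.
elim: n => [|n IHn]; last by rewrite !exprS sqmodM IHn.
by rewrite !expr0 /sqmod/= expr1n expr0n addr0.
Qed.

Lemma sqmod_ge0 z : 0 <= sqmod z.
Proof. by rewrite addr_ge0 ?sqr_ge0. Qed.

Lemma sqmod_gt0 z : (0 < sqmod z) = (z != 0).
Proof.
rewrite lt_def sqmod_ge0 andbT; congr negb; apply/eqP/eqP => [|->]; last first.
  by rewrite /sqmod/= expr0n addr0.
move=> /eqP; rewrite paddr_eq0 ?sqr_ge0// !sqrf_eq0 => /andP[/eqP a /eqP b].
exact: complex_ext.
Qed.

(** Write phi(theta) = r e^{i tau}. The variable cos(theta.Z - tau) has mean r, and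
    e^{-2 i tau} phi(2 theta) has real part E(2 cos(theta.Z - tau)^2 - 1), which is
    at least 2 r^2 - 1. In the proof V is r cos(theta.Z - tau), which spares the
    division by r, and N is r^2. *)
Lemma char_fun_double_neq0 d (T : measurableType d) (P : probability T R) k
    (Z : T -> k.-tuple R) theta : measurable_fun [set: T] Z ->
  1 / 2 < sqmod (char_fun P Z theta) -> char_fun P Z (2 *: theta) != 0.
Proof.
move=> mZ; set z := char_fun P Z theta; set N := sqmod z => N2.
have md : measurable_fun [set: T] (fun w => dot theta (Z w)).
  exact: measurable_dot.
have bc := bounded_measurable_cos md; have bs := bounded_measurable_sin md.
pose a := complex.Re z; pose b := complex.Im z.
pose V w := a * cos (dot theta (Z w)) + b * sin (dot theta (Z w)).
have bV : bounded_measurable V.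
  by apply: bounded_measurableD; exact: bounded_measurableZ.
have EV : \int[P]_w V w = N.
  rewrite expectD; [|exact: bounded_measurableZ|exact: bounded_measurableZ].
  by rewrite !expectZ// -Re_char_fun -Im_char_fun -/z /N /sqmod !expr2.
have EV2 : N ^+ 2 <= \int[P]_w (V w * V w).
  have bVV := bounded_measurableM bV bV.
  have : 0 <= \int[P]_w (V w * V w - 2 * N * V w + N ^+ 2).
    by apply: Rintegral_ge0 => w _; have := sqr_ge0 (V w - N); nra.
  rewrite expectD; last 2 first.
  - by apply: bounded_measurableB => //; exact: bounded_measurableZ.
  - exact: bounded_measurable_cst.
  rewrite expectB//; last exact: bounded_measurableZ.
  by rewrite expectZ// expect_cst EV; nra.
have E2 : (a ^+ 2 - b ^+ 2) * complex.Re (char_fun P Z (2 *: theta)) +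
    2 * a * b * complex.Im (char_fun P Z (2 *: theta)) =
    2 * \int[P]_w (V w * V w) - N.
  have md2 : measurable_fun [set: T] (fun w => dot (2 *: theta) (Z w)).
    exact: measurable_dot.
  have bc2 := bounded_measurable_cos md2; have bs2 := bounded_measurable_sin md2.
  have bVV := bounded_measurableM bV bV.
  rewrite Re_char_fun Im_char_fun -(expectZ _ _ bc2) -(expectZ _ _ bs2).
  rewrite -(expectZ _ _ bVV) -[X in _ = _ - X](expect_cst P).
  rewrite -expectD; [|exact: bounded_measurableZ|exact: bounded_measurableZ].
  rewrite -expectB; [|exact: bounded_measurableZ|exact: bounded_measurable_cst].
  apply: eq_Rintegral => w _; rewrite dotZ /V /N /sqmod -/a -/b.
  rewrite mulr_natl cos_mulr2n sin_mulr2n; have := cos2Dsin2 (dot theta (Z w)).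
  move: (cos _) (sin _) => c s cs.
  have e : s * s = 1 - c ^+ 2 by rewrite -cs; ring.
  rewrite (_ : (a * c + b * s) * (a * c + b * s) =
     a ^+ 2 * c ^+ 2 + 2 * a * b * (c * s) + b ^+ 2 * (s * s)); last by ring.
  by rewrite e; ring.
apply/eqP => z2; move: E2; rewrite z2/= !mulr0 addr0 => E2.
by nra.
Qed.

End NonVanishing.

Lemma continuous_sum (R : realType) (T : topologicalType) (n : nat)
    (f : 'I_n -> T -> R) x : (forall j, {for x, continuous (f j)}) ->
  {for x, continuous (fun y => \sum_(j < n) f j y)}.
Proof.
move=> cf; elim: (index_enum 'I_n) => [|j l IHl].
  rewrite (_ : (fun y => _) = fun=> 0); first exact: cvg_cst.
  by apply/funext => y; rewrite big_nil.
rewrite (_ : (fun y => _) = fun y => f j y + \sum_(i <- l) f i y).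
  by apply: continuousD; [exact: cf|exact: IHl].
by apply/funext => y; rewrite big_cons.
Qed.

Section InfinitelyDivisible.
Context {R : realType} d (T : measurableType d) (P : probability T R) (k : nat)
  (Z : T -> k.-tuple R).
Hypotheses (mZ : measurable_fun [set: T] Z) (idZ : infinitely_divisible_vector P Z).

Lemma measurable_sum_tuple d' (T' : measurableType d') n (Y : 'I_n -> T' -> k.-tuple R) :
  (forall i, measurable_fun [set: T'] (Y i)) ->
  measurable_fun [set: T'] (fun w => [tuple \sum_(i < n) tnth (Y i w) j | j < k]).
Proof.
move=> mY; apply/measurable_fun_tnthP => j.
rewrite (_ : _ \o _ = fun w => \sum_(i < n) tnth (Y i w) j); last first.
  by apply/funext => w /=; rewrite tnth_mktuple.
by apply: measurable_sum => i; have /measurable_fun_tnthP := mY i; exact.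
Qed.

Lemma char_fun_root n : (0 < n)%N ->
  exists (d' : measure_display) (T' : measurableType d') (P' : probability T' R)
    (Y : T' -> k.-tuple R), measurable_fun [set: T'] Y /\
    forall theta, char_fun P Z theta = char_fun P' Y theta ^+ n.
Proof.
move=> n0; have [d' [T' [P' [Y [mY iY sY ZY]]]]] := idZ n0.
exists d', T', P', (Y (Ordinal n0)); split => // theta.
rewrite (same_law_char_fun mZ (measurable_sum_tuple mY) ZY) char_fun_sum//.
rewrite (eq_bigr (fun=> char_fun P' (Y (Ordinal n0)) theta)).
  by rewrite prodr_const card_ord.
by move=> i _; rewrite (same_law_char_fun (mY i) (mY (Ordinal n0)) (sY _ _)).
Qed.

(** If phi = phi_n ^ n and phi(theta) is nonzero, then |phi_n(theta)|^2 > 1/2 for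
    large n, and char_fun_double_neq0 applies to phi_n. *)
Lemma id_char_fun_double theta :
  char_fun P Z theta != 0 -> char_fun P Z (2 *: theta) != 0.
Proof.
rewrite -sqmod_gt0 => z0.
have [n n0 hn] : exists2 n, (0 < n)%N & (1 / 2) ^+ n < sqmod (char_fun P Z theta).
  have : (1 / 2 : R) ^+ n @[n --> \oo] --> 0 by apply: cvg_expr; rewrite ger0_norm; lra.
  move=> /cvgrPdist_lt/(_ _ z0)[n _ H]; exists n.+1 => //.
  have := H n.+1 (leqnSn n); rewrite /= sub0r normrN ger0_norm// exprn_ge0//; lra.
have [d' [T' [P' [Y [mY ZY]]]]] := char_fun_root n0.
rewrite ZY expf_neq0// char_fun_double_neq0//.
move: hn; rewrite ZY sqmodX; apply: contraLR; rewrite -!leNgt => h.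
by apply: lerXn2r => //; rewrite nnegrE ?sqmod_ge0//; lra.
Qed.

(** Near 0 a characteristic function does not vanish, and doubling reaches every
    point from there. *)
Lemma id_char_fun_neq0 theta : char_fun P Z theta != 0.
Proof.
have [h h0 oh] := osc_cvg0 P mZ (ltr01 : 0 < 1 :> R).
have [n hn] : exists n, `|2^-1 ^+ n *: theta| <= h.
  have : (2^-1 : R) ^+ n * `|theta| @[n --> \oo] --> 0 * `|theta|.
    by apply: cvgMr_tmp; apply: cvg_expr; rewrite ger0_norm; lra.
  rewrite mul0r => /cvgrPdist_lt/(_ _ h0)[n _ /(_ n (leqnn n))].
  rewrite /= sub0r normrN => /ltW hn; exists n.
  by rewrite normrZ; rewrite normrM normr_id in hn.
have base : char_fun P Z (2^-1 ^+ n *: theta) != 0.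
  have := @char_fun_osc _ _ _ P _ Z (2^-1 ^+ n *: theta) 0 h mZ.
  rewrite subr0 => /(_ hn)[+ _]; rewrite char_fun0 => le.
  apply/eqP => z0; move: le; rewrite z0/= sub0r normrN normr1.
  by rewrite leNgt oh.
elim: n {hn} theta base => [|n IHn] theta; first by rewrite expr0 scale1r.
move=> base; have -> : theta = 2 *: (2^-1 *: theta).
  by rewrite scalerA divff ?scale1r// pnatr_eq0.
by apply: id_char_fun_double; apply: IHn; rewrite scalerA -exprSr.
Qed.

End InfinitelyDivisible.

(** * Continuous arguments of planar paths *)

Section Lift.
Context {R : realType}.

Definition is_arg (c s b : R) := exists2 r, 0 < r & c = r * cos b /\ s = r * sin b.

Lemma cos_atan_gt0 (x : R) : 0 < cos (atan x).
Proof. by apply: cos_gt0_pihalf; rewrite atan_gtNpi2 atan_ltpi2. Qed.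

Lemma sin_atan (x : R) : sin (atan x) = x * cos (atan x).
Proof. by rewrite -{2}(atanK x) /tan mulfVK// gt_eqF// cos_atan_gt0. Qed.

(** The angle from (c, s) to (c', s') is the arctangent of the quotient of the
    cross product by the dot product, as long as it is acute. *)
Lemma is_arg_step (c s b c' s' : R) : is_arg c s b -> 0 < c * c' + s * s' ->
  is_arg c' s' (b + atan ((c * s' - s * c') / (c * c' + s * s'))).
Proof.
move=> [r r0 [-> ->]]; set D := _ + _ => D0; set x := _ / _.
have := cos_atan_gt0 x; rewrite /is_arg cosD sinD sin_atan.
set q := cos (atan x) => q0; have Dn0 : D != 0 by rewrite gt_eqF.
have [rn0 qn0] : r != 0 /\ q != 0 by rewrite !gt_eqF.
have xD : x * D = r * cos b * s' - r * sin b * c' by rewrite mulfVK.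
exists (D / (r * q)); first by rewrite divr_gt0// mulr_gt0.
have cs1 := cos2Dsin2 b; split.
- have -> : D / (r * q) * (cos b * q - sin b * (x * q)) =
      (D * cos b - sin b * (x * D)) / r by field; rewrite rn0 qn0.
  rewrite xD -[LHS]mulr1 -cs1 /D; field; exact: rn0.
- have -> : D / (r * q) * (sin b * q + cos b * (x * q)) =
      (D * sin b + cos b * (x * D)) / r by field; rewrite rn0 qn0.
  rewrite xD -[LHS]mulr1 -cs1 /D; field; exact: rn0.
Qed.

Lemma is_arg_diff (c1 s1 b1 c2 s2 b2 : R) : is_arg c1 s1 b1 -> is_arg c2 s2 b2 ->
  exists2 r, 0 < r & c2 * c1 + s2 * s1 = r * cos (b1 - b2) /\
    c2 * s1 - s2 * c1 = r * sin (b1 - b2).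
Proof.
move=> [r1 r10 [-> ->]] [r2 r20 [-> ->]]; exists (r1 * r2); first exact: mulr_gt0.
by rewrite cosB sinB; split; ring.
Qed.

(** The dot product of two points differs from the square of the distance of the
    first one to 0 by at most 2 e. *)
Lemma acute_of_close (m e x y x' y' : R) : m <= x ^+ 2 + y ^+ 2 -> e < m / 2 ->
  `|x| <= 1 -> `|y| <= 1 -> `|x - x'| <= e -> `|y - y'| <= e ->
  0 < x * x' + y * y'.
Proof.
move=> hm em x1 y1 xx yy.
have hx : x * (x - x') <= e.
  by rewrite (le_trans (ler_norm _))// normrM (le_trans _ xx)// ler_piMl.
have hy : y * (y - y') <= e.
  by rewrite (le_trans (ler_norm _))// normrM (le_trans _ yy)// ler_piMl.
by nra.
Qed.

(** Two continuous arguments that agree at time 0, of paths that stay within a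
    right angle of each other, differ at time 1 by the angle between the paths
    there: their difference never crosses a zero of the cosine. *)
Lemma arg_stability (c1 s1 b1 c2 s2 b2 : R -> R) :
  {within `[(0 : R), 1], continuous b1} -> {within `[0, 1], continuous b2} ->
  b1 0 = b2 0 ->
  (forall t, 0 <= t <= 1 -> is_arg (c1 t) (s1 t) (b1 t)) ->
  (forall t, 0 <= t <= 1 -> is_arg (c2 t) (s2 t) (b2 t)) ->
  (forall t, 0 <= t <= 1 -> 0 < c2 t * c1 t + s2 t * s1 t) ->
  b1 1 - b2 1 =
    atan ((c2 1 * s1 1 - s2 1 * c1 1) / (c2 1 * c1 1 + s2 1 * s1 1)).
Proof.
move=> cb1 cb2 b0 a1 a2 dot0.
pose D t := b1 t - b2 t.
have cD : {within `[(0 : R), 1], continuous D}.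
  by move=> t; apply: continuousB; [exact: cb1|exact: cb2].
have D0 : D 0 = 0 by rewrite /D b0 subrr.
have cosD0 t : 0 <= t <= 1 -> 0 < cos (D t).
  move=> t01; have [r r0 [E _]] := is_arg_diff (a1 t t01) (a2 t t01).
  by have := dot0 t t01; rewrite E pmulr_rgt0.
have noval v : cos v = 0 -> ~ (Num.min (D 0) (D 1) <= v <= Num.max (D 0) (D 1)).
  move=> cv Hv; have [t] := IVT ler01 cD Hv.
  rewrite in_itv/= => /cosD0; move=> + Dt; rewrite Dt cv ltxx//.
have pi0 : 0 < pi / 2 :> R by have := @pihalf_ge1 R; lra.
have hi : D 1 < pi / 2.
  rewrite ltNge; apply/negP => h; apply: (noval (pi / 2)); first exact: cos_pihalf.
  by rewrite D0 min_l ?max_r ?h ?ltW//; lra.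
have lo : - (pi / 2) < D 1.
  rewrite ltNge; apply/negP => h; apply: (noval (- (pi / 2))).
    by rewrite cosN cos_pihalf.
  by rewrite D0 min_r ?max_l ?h//; lra.
have i01 : 0 <= (1 : R) <= 1 by rewrite ler01 lexx.
have [r r0 [-> ->]] := is_arg_diff (a1 1 i01) (a2 1 i01).
rewrite -mulf_div divff ?gt_eqF// mul1r -/(tan (D 1)) tanK//.
by rewrite in_itv/= lo hi.
Qed.

(** Existence of a continuous argument along a path in the punctured plane: the
    small angles between consecutive points of a fine subdivision are summed. *)
Lemma exists_arg (c s : R -> R) N : (0 < N)%N -> continuous c -> continuous s ->
  c 0 = 1 -> s 0 = 0 ->
  (forall t u, 0 <= t <= 1 -> 0 <= u <= 1 -> `|t - u| <= N%:R^-1 ->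
     0 < c t * c u + s t * s u) ->
  exists b, [/\ {within `[(0 : R), 1], continuous b}, b 0 = 0 &
    forall t, 0 <= t <= 1 -> is_arg (c t) (s t) (b t)].
Proof.
move=> N0 cc cs c0 s0 close.
pose pt (j : nat) (t : R) := j%:R / N%:R * t.
pose D j t := c (pt j t) * c (pt j.+1 t) + s (pt j t) * s (pt j.+1 t).
pose g j t := atan ((c (pt j t) * s (pt j.+1 t) - s (pt j t) * c (pt j.+1 t)) / D j t).
have N0R : 0 < N%:R :> R by rewrite ltr0n.
have pt01 j t : (j <= N)%N -> 0 <= t <= 1 -> 0 <= pt j t <= 1.
  move=> jN /andP[t0 t1]; rewrite /pt mulr_ge0 ?divr_ge0//= mulr_ile1 ?divr_ge0//.
  by rewrite ler_pdivrMr// mul1r ler_nat.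
have D0 j t : (j < N)%N -> 0 <= t <= 1 -> 0 < D j t.
  move=> jN t01; apply: close; [exact/pt01/t01/ltnW|exact: pt01|].
  have /andP[t0 t1] := t01.
  rewrite /pt -mulrBl -mulrBl -natr1 opprD addrA subrr sub0r normrM normrM normrN1 mul1r.
  by rewrite gtr0_norm ?invr_gt0// ger0_norm// ler_piMr// invr_ge0.
pose b t := \sum_(j < N) g j t.
have part t n : (n <= N)%N -> 0 <= t <= 1 ->
    is_arg (c (pt n t)) (s (pt n t)) (\sum_(j < n) g j t).
  move=> + t01; elim: n => [_|n IHn nN].
    rewrite /pt !mul0r big_ord0 c0 s0; exists 1 => //.
    by rewrite cos0 sin0 mulr0 mulr1.
  by rewrite big_ord_recr/=; apply: is_arg_step; [exact/IHn/ltnW|exact: D0].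
have cpt j : continuous (pt j) by move=> t; apply: cvgMl_tmp; exact: cvg_id.
have ccpt j t : {for t, continuous (fun t => c (pt j t))}.
  by apply: continuous_comp; [exact: cpt|exact: cc].
have cspt j t : {for t, continuous (fun t => s (pt j t))}.
  by apply: continuous_comp; [exact: cpt|exact: cs].
have cg j t : (j < N)%N -> 0 <= t <= 1 -> {for t, continuous (g j)}.
  move=> jN t01; apply: continuous_comp; last exact: continuous_atan.
  apply: continuousM.
    by apply: continuousB; apply: continuousM; [exact: ccpt|exact: cspt|exact: cspt|exact: ccpt].
  apply: continuousV; first by rewrite gt_eqF// D0.
  by apply: continuousD; apply: continuousM; [exact: ccpt|exact: ccpt|exact: cspt|exact: cspt].
exists b; split.
- apply: continuous_in_subspaceT => t; rewrite inE/= in_itv/= => t01.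
  by apply: continuous_sum => j; exact: cg.
- rewrite /b big1// => j _.
  by rewrite /g /D /pt !mulr0 c0 s0 !(mulr0, mul0r, subr0) atan0.
- move=> t t01; have := part t N (leqnn N) t01.
  by rewrite /pt divff ?gt_eqF// mul1r.
Qed.

End Lift.

(** * Characteristic exponents: existence and uniqueness *)

Section ComplexContinuity.
Context {R : realType}.

Lemma continuous_complexP (V : topologicalType) (f : V -> R[i]) :
  continuous (f : V -> R[i]^o) <->
  continuous (fun x => complex.Re (f x)) /\ continuous (fun x => complex.Im (f x)).
Proof.
have normE (a b : R) : `|a +i* b|%C = (Num.sqrt (a ^+ 2 + b ^+ 2))%:C%C by [].
have realgt0 (e : R[i]) : 0 < e -> 0 < complex.Re e /\ e = (complex.Re e)%:C%C.
  by case: e => a b; rewrite ltcE/= => /andP[/eqP -> ?].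
split=> [cf|[cr ci] x].
  have le (z : R[i]) (e : R) : `|z| < e%:C%C ->
      `|complex.Re z| < e /\ `|complex.Im z| < e.
    case: z => a b; rewrite normE ltcR => h.
    by split; apply: le_lt_trans h; rewrite -sqrtr_sqr ler_wsqrtr//=
      ?lerDl ?lerDr ?sqr_ge0.
  split=> x; apply/cvgrPdist_lt => e e0;
    have ec0 : 0 < e%:C%C :> R[i] by rewrite ltcR.
    have /cvgrPdist_lt/(_ _ ec0) := cf x.
    apply: filterS => y /le[+ _]; by case: (f x) => ? ?; case: (f y).
  have /cvgrPdist_lt/(_ _ ec0) := cf x.
  apply: filterS => y /le[_]; by case: (f x) => ? ?; case: (f y).
apply/cvgrPdist_lt => e /realgt0[e0 ->]; set a := complex.Re e in e0 *.
have a20 : 0 < a / 2 by lra.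
have /cvgrPdist_lt/(_ _ a20) Hr := cr x; have /cvgrPdist_lt/(_ _ a20) Hi := ci x.
near=> y; have := near Hr y; have := near Hi y.
move=> /(_ _)/wrap[//|hi] /(_ _)/wrap[//|hr].
move: hr hi; case: (f x) => u v; case: (f y) => u' v'/= hr hi.
rewrite normE ltcR.
have la : Num.sqrt ((u - u') ^+ 2 + (v - v') ^+ 2) <= `|u - u'| + `|v - v'|.
  rewrite -(@ler_pXn2r _ 2)// ?nnegrE ?addr_ge0 ?sqrtr_ge0//.
  rewrite sqr_sqrtr ?addr_ge0 ?sqr_ge0//.
  have e1 := real_normK (num_real (u - u')); have e2 := real_normK (num_real (v - v')).
  have := mulr_ge0 (normr_ge0 (u - u')) (normr_ge0 (v - v')).
  by move=> uv; rewrite [leRHS]sqrrD e1 e2; lra.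
by lra.
Unshelve. all: by end_near. Qed.

Lemma continuous_of_local (V : normedModType R) (f : V -> R) :
  (forall x, exists h G, [/\ 0 < h, {for x, continuous G} &
     forall y, `|x - y| <= h -> f y = G y]) -> continuous f.
Proof.
move=> H x; have [h [G [h0 cG fG]]] := H x.
rewrite /continuous_at fG ?subrr ?normr0 ?ltW//.
apply: cvg_trans cG; apply: near_eq_cvg; apply/nbhs_normP.
by exists h => //= y /ltW xy; rewrite fG.
Qed.

Lemma continuous_ray (V : normedModType R) (f : V -> R) (x : V) :
  continuous f -> continuous (fun t : R => f (t *: x)).
Proof.
move=> cf t; apply: (continuous_comp (f := fun t : R => t *: x)); last exact: cf.
exact: scalel_continuous.
Qed.

Lemma continuous_sqsum (V : topologicalType) (f g : V -> R) :
  continuous f -> continuous g -> continuous (fun x => f x ^+ 2 + g x ^+ 2).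
Proof.
move=> cf cg x; exact: (cvgD (cvgM (cf x) (cf x)) (cvgM (cg x) (cg x))).
Qed.

Lemma continuous_angle (V : topologicalType) (f g : V -> R) a x :
  continuous f -> continuous g -> 0 < f x * f x + g x * g x ->
  {for x, continuous (fun y =>
     a + atan ((f x * g y - g x * f y) / (f x * f y + g x * g y)))}.
Proof.
move=> cf cg /lt0r_neq0 D0.
have num : f x * g y - g x * f y @[y --> x] --> f x * g x - g x * f x.
  exact: (cvgB (cvgM (cvg_cst _) (cg x)) (cvgM (cvg_cst _) (cf x))).
have den : f x * f y + g x * g y @[y --> x] --> f x * f x + g x * g x.
  exact: (cvgD (cvgM (cvg_cst _) (cf x)) (cvgM (cvg_cst _) (cg x))).
apply: cvgD; first exact: cvg_cst.
apply: (@continuous_comp _ _ _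
  (fun y => (f x * g y - g x * f y) / (f x * f y + g x * g y)) atan).
  exact: (cvgM num (cvgV D0 den)).
exact: continuous_atan.
Qed.

Lemma cexpD (z z' : R[i]) : cexp (z + z') = cexp z * cexp z'.
Proof.
case: z => a b; case: z' => a' b'; rewrite /cexp/= expRD cosD sinD.
by apply: complex_ext => /=; ring.
Qed.

Lemma cexp_natl n (z : R[i]) : cexp (n%:R * z) = cexp z ^+ n.
Proof.
elim: n => [|n IHn]; last by rewrite -natr1 mulrDl mul1r cexpD IHn exprSr.
by rewrite mul0r expr0 /cexp/= expR0 cos0 sin0 mulr0 mulr1.
Qed.

End ComplexContinuity.

Section CharExponent.
Context {R : realType} d (T : measurableType d) (P : probability T R) (k : nat)
  (Z : T -> k.-tuple R).
Hypothesis mZ : measurable_fun [set: T] Z.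

Let c theta := complex.Re (char_fun P Z theta).
Let s theta := complex.Im (char_fun P Z theta).

Lemma sqmod_ray_min (theta : 'rV[R]_k) : (forall eta, char_fun P Z eta != 0) ->
  exists2 m, 0 < m & forall t, 0 <= t <= 1 ->
    m <= c (t *: theta) ^+ 2 + s (t *: theta) ^+ 2.
Proof.
move=> nz; have [cc cs] := char_fun_continuous P mZ.
have cf := continuous_sqsum (continuous_ray (x := theta) cc) (continuous_ray (x := theta) cs).
have [t0 _ t0min] := EVT_min ler01 (continuous_subspaceT cf).
exists (c (t0 *: theta) ^+ 2 + s (t0 *: theta) ^+ 2) => [|t t01].
  by have := sqmod_gt0 (char_fun P Z (t0 *: theta)); rewrite nz.
by apply: t0min; rewrite in_itv.
Qed.

Lemma ray_arg (theta : 'rV[R]_k) : (forall eta, char_fun P Z eta != 0) ->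
  exists b, [/\ {within `[(0 : R), 1], continuous b}, b 0 = 0 &
    forall t, 0 <= t <= 1 -> is_arg (c (t *: theta)) (s (t *: theta)) (b t)].
Proof.
move=> nz; have [cc cs] := char_fun_continuous P mZ.
have [m m0 hm] := sqmod_ray_min theta nz.
have m20 : 0 < m / 2 by lra.
have [h h0 oh] := osc_cvg0 P mZ m20.
pose N := (Num.trunc (`|theta| / h)).+1.
have Nh : `|theta| / N%:R <= h.
  rewrite ler_pdivrMr ?ltr0n// mulrC -ler_pdivrMr//.
  have th0 : 0 <= `|theta| / h by rewrite divr_ge0// ltW.
  by have /andP[_ /ltW] := truncn_itv th0.
apply: (@exists_arg _ _ _ N) => //.
- exact: continuous_ray.
- exact: continuous_ray.
- by rewrite scale0r /c char_fun0.
- by rewrite scale0r /s char_fun0.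
- move=> t u t01 u01 tu.
  have [t1 t2] := char_fun_le1 P (t *: theta) mZ.
  have le : `|t *: theta - u *: theta| <= h.
    rewrite -scalerBl normrZ (le_trans _ Nh)// mulrC ler_wpM2l//.
  have [hc hs] := char_fun_osc P mZ le.
  exact: acute_of_close (hm t t01) oh t1 t2 hc hs.
Qed.

(** The argument at theta is the endpoint of the lift along the ray through theta.
    It is continuous in theta because the rays through close points have
    uniformly close images, which lets arg_stability compare the lifts. *)
Lemma exists_char_exponent : (forall eta, char_fun P Z eta != 0) ->
  exists psi, is_char_exponent P Z psi.
Proof.
move=> nz; have [cc cs] := char_fun_continuous P mZ.
have [b Hb] := choice (fun theta => ray_arg theta nz).
have i01 : 0 <= (1 : R) <= 1 by rewrite ler01 lexx.
pose arg theta := b theta 1.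
have argP theta : is_arg (c theta) (s theta) (arg theta).
  by have [_ _ /(_ 1 i01)] := Hb theta; rewrite scale1r.
have carg : continuous arg.
  apply: continuous_of_local => theta.
  have [m m0 hm] := sqmod_ray_min theta nz.
  have m20 : 0 < m / 2 by lra.
  have [h h0 oh] := osc_cvg0 P mZ m20.
  exists h, (fun eta => arg theta +
    atan ((c theta * s eta - s theta * c eta) / (c theta * c eta + s theta * s eta))).
  split => //.
    apply: (continuous_angle cc cs); rewrite -!expr2.
    by have := hm 1 i01; rewrite scale1r; exact: lt_le_trans.
  move=> eta te; have [ct bt0 at_] := Hb theta; have [ce be0 ae] := Hb eta.
  have := arg_stability ce ct _ ae at_; rewrite bt0 be0 => /(_ erefl).
  rewrite !scale1r => <-; first by rewrite addrC subrK.
  move=> t t01; have [t1 t2] := char_fun_le1 P (t *: theta) mZ.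
  have le : `|t *: theta - t *: eta| <= h.
    rewrite -scalerBr normrZ (le_trans _ te)//; have /andP[? ?] := t01.
    by rewrite ger0_norm// ler_piMl.
  have [hc hs] := char_fun_osc P mZ le.
  exact: acute_of_close (hm t t01) oh t1 t2 hc hs.
pose L theta := ln (sqmod (char_fun P Z theta)) / 2.
exists (fun theta => (- L theta) +i* (- arg theta))%C; split.
- apply/continuous_complexP; split=> theta /=; last by apply: continuousN; exact: carg.
  apply: continuousN; apply: continuousM; last exact: cst_continuous.
  apply: continuous_comp; last by apply: continuous_ln; rewrite sqmod_gt0.
  exact: (continuous_sqsum cc cs).
- have arg0 : arg 0 = 0.
    have [c0 b0 a0] := Hb 0.
    have cst0 : {within `[(0 : R), 1], continuous (fun=> 0 : R)}.
      by apply: continuous_subspaceT => t; exact: cst_continuous.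
    have acst (t : R) : 0 <= t <= 1 -> is_arg 1 0 (0 : R).
      by move=> _; exists 1 => //; rewrite cos0 sin0 mulr1 mulr0.
    have E t : c (t *: 0) = 1 /\ s (t *: 0) = 0 by rewrite scaler0 /c /s char_fun0.
    have := @arg_stability R _ _ _ (fun=> 1) (fun=> 0) _ c0 cst0 b0 a0 acst; rewrite !(E _).1 !(E _).2.
    rewrite /arg subr0 => ->; first by rewrite mulr0 mul0r subrr mul0r atan0.
    by move=> t _; rewrite (E _).1 (E _).2 mulr0 addr0 mulr1.
  by rewrite arg0 /L char_fun0 /sqmod/= expr1n expr0n addr0 ln1 mul0r !oppr0.
- move=> theta; have [r r0 [cE sE]] := argP theta.
  have Lr : expR (L theta) = r.
    rewrite /L /sqmod -/(c theta) -/(s theta) cE sE !exprMn -mulrDr cos2Dsin2 mulr1.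
    by rewrite lnXn// mulr2n -[X in X + X]mulr1 -mulrDr -mulrA divff ?mulr1 ?lnK.
  by apply: complex_ext; rewrite /cexp/= !opprK Lr.
Qed.

Lemma char_exponent_arg psi : is_char_exponent P Z psi -> forall theta,
  is_arg (c theta) (s theta) (- complex.Im (psi theta)).
Proof.
move=> [_ _ psiE] theta; exists (expR (- complex.Re (psi theta))).
  exact: expR_gt0.
by rewrite /c /s psiE /cexp/=; case: (psi theta).
Qed.

Lemma char_exponent_Re psi : is_char_exponent P Z psi -> forall theta,
  complex.Re (psi theta) = - (ln (sqmod (char_fun P Z theta)) / 2).
Proof.
move=> [_ _ psiE] theta; rewrite psiE; case: (psi theta) => a b/=.
rewrite /sqmod/= !exprMn -mulrDr cos2Dsin2 mulr1 lnXn ?expR_gt0// expRK.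
by rewrite mulr2n; field.
Qed.

Lemma char_exponent_neq0 psi : is_char_exponent P Z psi ->
  forall theta, char_fun P Z theta != 0.
Proof.
move=> psiP theta; rewrite -sqmod_gt0.
have [r r0 [cE sE]] := char_exponent_arg psiP theta.
rewrite /sqmod -/(c theta) -/(s theta) cE sE !exprMn -mulrDr cos2Dsin2 mulr1.
exact: exprn_gt0.
Qed.

Lemma char_exponent_ray psi (theta : 'rV[R]_k) : is_char_exponent P Z psi ->
  {within `[(0 : R), 1], continuous (fun t => - complex.Im (psi (t *: theta)))} /\
  - complex.Im (psi (0 *: theta)) = 0.
Proof.
move=> [/continuous_complexP[_ ci] psi0 _]; split.
  apply: continuous_subspaceT => t; apply: continuousN.
  exact: (continuous_ray ci).
by rewrite scale0r psi0 oppr0.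
Qed.

(** The real part is determined by |phi|. The imaginary parts are continuous
    arguments along the same path on each ray, so arg_stability identifies
    them. *)
Lemma char_exponent_unique psi psi' :
  is_char_exponent P Z psi -> is_char_exponent P Z psi' -> psi = psi'.
Proof.
move=> pP pP'; apply/funext => theta; apply: complex_ext.
  by rewrite (char_exponent_Re pP) (char_exponent_Re pP').
have [cb b0] := char_exponent_ray theta pP; have [cb' b0'] := char_exponent_ray theta pP'.
have ap t := char_exponent_arg pP (t *: theta).
have ap' t := char_exponent_arg pP' (t *: theta).
have := arg_stability cb cb' _ (fun t _ => ap t) (fun t _ => ap' t).
rewrite b0 b0' => /(_ erefl); rewrite !scale1r => H.
apply: oppr_inj; apply/eqP; rewrite -subr_eq0; apply/eqP.
rewrite H; first by rewrite [s theta * _]mulrC subrr mul0r atan0.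
move=> t _; rewrite -!expr2.
by have := sqmod_gt0 (char_fun P Z (t *: theta)); rewrite (char_exponent_neq0 pP).
Qed.

Lemma char_exponentE psi : is_char_exponent P Z psi -> char_exponent P Z = psi.
Proof.
move=> psiP; apply: xget_subset1 => // p p' hp hp'.
exact: char_exponent_unique.
Qed.

Lemma id_char_exponentP : infinitely_divisible_vector P Z ->
  is_char_exponent P Z (char_exponent P Z).
Proof.
move=> idZ; have [psi psiP] := exists_char_exponent (id_char_fun_neq0 mZ idZ).
by rewrite (char_exponentE psiP).
Qed.

End CharExponent.

(** * Convergence of characteristic exponents *)

Section Closeness.
Context {R : realType}.

Definition coord_close (e : R) (z z' : R[i]) :=
  `|complex.Re z - complex.Re z'| <= e /\ `|complex.Im z - complex.Im z'| <= e.

Lemma coord_close_trans e e' (x y z : R[i]) : coord_close e x y -> coord_close e' y z ->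
  coord_close (e + e') x z.
Proof.
move=> [xy1 xy2] [yz1 yz2]; split.
- by rewrite (le_trans (ler_distD (complex.Re y) _ _))// lerD.
- by rewrite (le_trans (ler_distD (complex.Im y) _ _))// lerD.
Qed.

Lemma coord_close_le e e' (x y : R[i]) : e <= e' -> coord_close e x y -> coord_close e' x y.
Proof. by move=> ee [h1 h2]; split; exact: le_trans ee. Qed.

End Closeness.

Section Convergence.
Context {R : realType} d (T : measurableType d) (P : probability T R) (k : nat).
Context (Zn : nat -> T -> k.-tuple R) (Z : T -> k.-tuple R).
Hypotheses (mZn : forall n, measurable_fun [set: T] (Zn n))
  (mZ : measurable_fun [set: T] Z) (cvgZ : cvg_in_distribution P Zn Z).

Lemma continuous_coord (g : R -> R) (j : 'I_k) (x : 'rV[R]_k) : continuous g ->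
  {for x, continuous (fun x : 'rV[R]_k => g (x 0 j))}.
Proof.
move=> cg; apply: (continuous_comp (f := fun x : 'rV[R]_k => x 0 j)).
  exact: coord_continuous.
exact: cg.
Qed.

Lemma char_fun_cvg theta e : 0 < e ->
  \forall n \near \oo, coord_close e (char_fun P (Zn n) theta) (char_fun P Z theta).
Proof.
move=> e0.
have cdot : continuous (fun x : 'rV[R]_k => \sum_(j < k) theta 0 j * x 0 j).
  move=> x; apply: continuous_sum => j; apply: (continuous_coord (g := *%R (theta 0 j))).
  by move=> r; apply: mulrl_continuous.
have dotE (Y : T -> k.-tuple R) w :
    \sum_(j < k) theta 0 j * tuple_row (Y w) 0 j = dot theta (Y w).
  by apply: eq_bigr => j _; rewrite mxE.
have cvg_of (g : R -> R) : continuous g -> (forall x, `|g x| <= 1) ->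
    \int[P]_w g (dot theta (Zn n w)) @[n --> \oo] --> \int[P]_w g (dot theta (Z w)).
  move=> cg g1; pose f (x : 'rV[R]_k) := g (\sum_(j < k) theta 0 j * x 0 j).
  have -> : \int[P]_w g (dot theta (Z w)) = \int[P]_w f (tuple_row (Z w)).
    by apply: eq_Rintegral => w _; rewrite /f dotE.
  rewrite (_ : (fun n => _) = fun n => \int[P]_w f (tuple_row (Zn n w))); last first.
    by apply/funext => n; apply: eq_Rintegral => w _; rewrite /f dotE.
  apply: cvgZ; last by exists 1 => x; exact: g1.
  by move=> x; apply: (continuous_comp (cdot x)); exact: cg.
have /cvgrPdist_le/(_ _ e0) Hc := cvg_of _ (@continuous_cos R) (@cos_max R).
have /cvgrPdist_le/(_ _ e0) Hs := cvg_of _ (@continuous_sin R) (@sin_max R).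
near=> n; rewrite /coord_close !Re_char_fun !Im_char_fun.
by rewrite distrC [X in _ /\ X <= _]distrC; split; [near: n|near: n].
Unshelve. all: by end_near. Qed.

Lemma osc_cvg h : 0 <= h -> osc P (Zn n) h @[n --> \oo] --> osc P Z h.
Proof.
move=> h0; pose f (x : 'rV[R]_k) : R := Num.min 2 (h * \sum_(j < k) `|x 0 j|).
have fE (Y : T -> k.-tuple R) w : f (tuple_row (Y w)) = Num.min 2 (h * norm1 (Y w)).
  by rewrite /f /norm1; congr (Num.min _ (_ * _)); apply: eq_bigr => j _; rewrite mxE.
have -> : osc P Z h = \int[P]_w f (tuple_row (Z w)).
  by apply: eq_Rintegral => w _; rewrite fE.
rewrite (_ : (fun n => _) = fun n => \int[P]_w f (tuple_row (Zn n w))); last first.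
  by apply/funext => n; apply: eq_Rintegral => w _; rewrite fE.
apply: cvgZ.
  have cs : continuous (fun x : 'rV[R]_k => \sum_(j < k) `|x 0 j|).
    move=> x; apply: continuous_sum => j; apply: (continuous_coord (g := Num.norm)).
    exact: norm_continuous.
  move=> x; apply: (@continuous_comp _ _ _ (fun x : 'rV[R]_k => \sum_(j < k) `|x 0 j|)
    (fun r => Num.min 2 (h * r))); first exact: cs.
  have c2 : {for \sum_(j < k) `|x 0 j|, continuous (cst 2 : R -> R^o)}.
    exact: cst_continuous.
  have ch : {for \sum_(j < k) `|x 0 j|, continuous (fun r => h * r : R^o)}.
    exact: mulrl_continuous.
  exact: continuous_min c2 ch.
exists 2 => x; rewrite /f ger0_norm ?ge_min ?lexx// le_min ler0n/=.
by rewrite mulr_ge0// sumr_ge0.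
Qed.

(** Pointwise convergence suffices on a finite grid of the ray, and osc controls
    what happens between the points of the grid. *)
Lemma char_fun_cvg_ray (theta : 'rV[R]_k) (an : nat -> R) (a e : R) : 0 < e ->
  an n @[n --> \oo] --> a ->
  \forall n \near \oo, forall t, 0 <= t <= 1 ->
    coord_close e (char_fun P (Zn n) (t *: (an n *: theta))) (char_fun P Z (t *: (a *: theta))).
Proof.
move=> e0 cva; have e40 : 0 < e / 4 by lra.
have [h h0 oh] := osc_cvg0 P mZ e40.
pose L := (Num.trunc (`|a *: theta| / h)).+1.
have L0 : 0 < L%:R :> R by rewrite ltr0n.
have Lh : L%:R^-1 * `|a *: theta| <= h.
  rewrite mulrC ler_pdivrMr// mulrC -ler_pdivrMr//.
  have th0 : 0 <= `|a *: theta| / h by rewrite divr_ge0// ltW.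
  by have /andP[_ /ltW] := truncn_itv th0.
have oscn : \forall n \near \oo, osc P (Zn n) h <= e / 4.
  by apply: (cvgr_le _ (osc_cvg (ltW h0))).
have closea : \forall n \near \oo, `|an n *: theta - a *: theta| <= h.
  have : `|an n - a| * `|theta| @[n --> \oo] --> `|a - a| * `|theta|.
    apply: cvgMr_tmp; apply: cvg_norm; apply: cvgB => //; exact: cvg_cst.
  rewrite subrr normr0 mul0r => /cvgr_le/(_ _ h0).
  by apply: filterS => n; rewrite -scalerBl normrZ.
have grid : \forall n \near \oo, forall j : 'I_L.+1, coord_close (e / 4)
    (char_fun P (Zn n) ((j%:R / L%:R) *: (a *: theta)))
    (char_fun P Z ((j%:R / L%:R) *: (a *: theta))).
  by apply: filter_forall => j; exact: char_fun_cvg.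
near=> n => t /andP[t0 t1].
have on : osc P (Zn n) h <= e / 4 by near: n.
have an_ : `|an n *: theta - a *: theta| <= h by near: n.
have gn : forall j : 'I_L.+1, coord_close (e / 4)
    (char_fun P (Zn n) ((j%:R / L%:R) *: (a *: theta)))
    (char_fun P Z ((j%:R / L%:R) *: (a *: theta))) by near: n.
have tL0 : 0 <= t * L%:R by rewrite mulr_ge0// ltW.
have /andP[j1 j2] := truncn_itv tL0.
have jL : (Num.trunc (t * L%:R) < L.+1)%N.
  by rewrite ltnS -(ler_nat R) (le_trans j1)// ler_piMl// ltW.
pose j := Ordinal jL.
have tj : `|t *: (a *: theta) - (j%:R / L%:R) *: (a *: theta)| <= h.
  rewrite -scalerBl normrZ (le_trans _ Lh)// ler_wpM2r//.
  have -> : t - j%:R / L%:R = (t * L%:R - j%:R) / L%:R.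
    by rewrite mulrBl mulfK// gt_eqF.
  rewrite normrM [X in _ * X]gtr0_norm ?invr_gt0// ler_piMl ?invr_ge0 ?(ltW L0)//.
  rewrite ger0_norm ?subr_ge0// lerBlDr.
  by move: j2; rewrite -natr1 addrC => /ltW.
have s1 : coord_close (e / 4) (char_fun P (Zn n) (t *: (an n *: theta)))
                        (char_fun P (Zn n) (t *: (a *: theta))).
  apply: coord_close_le on _; apply: char_fun_osc => //.
  by rewrite -scalerBr normrZ ger0_norm// (le_trans _ an_)// ler_piMl.
have s2 : coord_close (e / 4) (char_fun P (Zn n) (t *: (a *: theta)))
                        (char_fun P (Zn n) ((j%:R / L%:R) *: (a *: theta))).
  by apply: coord_close_le on _; exact: char_fun_osc.
have s3 : coord_close (e / 4) (char_fun P Z ((j%:R / L%:R) *: (a *: theta)))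
                        (char_fun P Z (t *: (a *: theta))).
  by apply: coord_close_le (ltW oh) _; apply: char_fun_osc => //; rewrite distrC.
have -> : e = e / 4 + e / 4 + e / 4 + e / 4 by field.
exact: coord_close_trans (coord_close_trans (coord_close_trans s1 s2) (gn j)) s3.
Unshelve. all: by end_near. Qed.

(** The imaginary part is compared along the whole ray: uniform convergence there
    keeps the two paths within an acute angle, and arg_stability reduces the
    difference of the imaginary parts to the angle between the endpoints. *)
Lemma char_exponent_cvg (psin : nat -> 'rV[R]_k -> R[i]) psi (theta : 'rV[R]_k)
    (an : nat -> R) (a : R) :
  (forall n, is_char_exponent P (Zn n) (psin n)) -> is_char_exponent P Z psi ->
  an n @[n --> \oo] --> a ->
  complex.Re (psin n (an n *: theta)) @[n --> \oo] --> complex.Re (psi (a *: theta)) /\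
  complex.Im (psin n (an n *: theta)) @[n --> \oo] --> complex.Im (psi (a *: theta)).
Proof.
move=> pn p cva.
have nz := char_exponent_neq0 p.
pose cn n := complex.Re (char_fun P (Zn n) (an n *: theta)).
pose sn n := complex.Im (char_fun P (Zn n) (an n *: theta)).
pose c := complex.Re (char_fun P Z (a *: theta)).
pose s := complex.Im (char_fun P Z (a *: theta)).
have i01 : 0 <= (1 : R) <= 1 by rewrite ler01 lexx.
have cvc : cn n @[n --> \oo] --> c.
  apply/cvgrPdist_le => e e0; have := char_fun_cvg_ray theta e0 cva.
  by apply: filterS => n /(_ 1 i01); rewrite !scale1r => -[+ _]; rewrite distrC.
have cvs : sn n @[n --> \oo] --> s.
  apply/cvgrPdist_le => e e0; have := char_fun_cvg_ray theta e0 cva.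
  by apply: filterS => n /(_ 1 i01); rewrite !scale1r => -[_]; rewrite distrC.
have q0 : 0 < c ^+ 2 + s ^+ 2.
  by have := sqmod_gt0 (char_fun P Z (a *: theta)); rewrite nz.
split.
  rewrite (char_exponent_Re p).
  rewrite (_ : (fun n => _) = fun n => - (ln (cn n ^+ 2 + sn n ^+ 2) / 2)); last first.
    by apply/funext => n; rewrite (char_exponent_Re (pn n)).
  apply: cvgN; apply: cvgMr_tmp.
  have cq : cn n ^+ 2 + sn n ^+ 2 @[n --> \oo] --> c ^+ 2 + s ^+ 2.
    exact: (cvgD (cvgM cvc cvc) (cvgM cvs cvs)).
  by apply: (continuous_cvg _ _ cq); exact: continuous_ln.
have [m m0 hm] := sqmod_ray_min mZ (a *: theta) nz.
have m40 : 0 < m / 4 by lra.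
pose F n := atan ((c * sn n - s * cn n) / (c * cn n + s * sn n)).
have E : \forall n \near \oo,
    complex.Im (psi (a *: theta)) - F n = complex.Im (psin n (an n *: theta)).
  have := char_fun_cvg_ray theta m40 cva; apply: filterS => n Hn.
  have [cb b0] := char_exponent_ray (an n *: theta) (pn n).
  have [cb' b0'] := char_exponent_ray (a *: theta) p.
  have ap t := char_exponent_arg (pn n) (t *: (an n *: theta)).
  have ap' t := char_exponent_arg p (t *: (a *: theta)).
  have := arg_stability cb cb' _ (fun t _ => ap t) (fun t _ => ap' t).
  rewrite b0 b0' => /(_ erefl); rewrite !scale1r => H.
  rewrite /F /c /s /cn /sn -H; first by ring.
  move=> t t01; have [t1 t2] := char_fun_le1 P (t *: (a *: theta)) mZ.
  have [h1 h2] := Hn t t01.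
  apply: (acute_of_close (hm t t01) _ t1 t2 (e := m / 4)); first lra.
    by rewrite distrC.
  by rewrite distrC.
suff cv : complex.Im (psi (a *: theta)) - F n @[n --> \oo] -->
    complex.Im (psi (a *: theta)) by exact: cvg_trans (near_eq_cvg E) cv.
rewrite -[X in _ --> X]subr0; apply: cvgB; first exact: cvg_cst.
have cF : (c * sn n - s * cn n) / (c * cn n + s * sn n) @[n --> \oo] -->
    (c * s - s * c) / (c * c + s * s).
  apply: cvgM; first exact: (cvgB (cvgM (cvg_cst _) cvs) (cvgM (cvg_cst _) cvc)).
  apply: cvgV; first by rewrite -!expr2 gt_eqF.
  exact: (cvgD (cvgM (cvg_cst _) cvc) (cvgM (cvg_cst _) cvs)).
rewrite [s * c]mulrC subrr mul0r in cF; rewrite -atan0.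
by apply: (continuous_cvg _ _ cF); exact: continuous_atan.
Qed.

End Convergence.

(** * Dilative stability and aggregate similarity *)

Lemma powRD_gt0 (R : realType) (x r s : R) : 0 < x ->
  x `^ r * x `^ s = x `^ (r + s).
Proof. by move=> /lt0r_neq0 x0; rewrite powRD// x0 implybT. Qed.

Lemma continuous_dilate (R : realType) (V : normedModType R) (f : V -> R) (q a : R) :
  continuous f -> continuous (fun x => q * f (a *: x)).
Proof.
move=> cf x; apply: cvgMl_tmp.
apply: (@continuous_comp _ _ _ (fun x : V => a *: x) f); last exact: cf.
exact: scaler_continuous.
Qed.

Lemma rational_cvg (R : realType) (x : R) : 0 < x -> exists p : nat -> nat,
  (forall n, (0 < p n)%N) /\ (p n)%:R / n.+1%:R @[n --> \oo] --> x.
Proof.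
move=> x0; exists (fun n => (Num.trunc (x * n.+1%:R)).+1); split => //.
apply: (@squeeze_cvgr _ _ _ _ (fun=> x) (fun n => x + n.+1%:R^-1)).
- near=> n; have nx0 : 0 <= x * n.+1%:R by rewrite mulr_ge0// ltW.
  have /andP[h1 h2] := truncn_itv nx0.
  rewrite ler_pdivlMr// (ltW h2)/= ler_pdivrMr// mulrDl mulVf// -natr1.
  by rewrite lerD2r.
- exact: cvg_cst.
- rewrite -[X in _ --> X]addr0; apply: cvgD; first exact: cvg_cst.
  exact: cvg_harmonic.
Unshelve. all: by end_near. Qed.

Lemma powR_cvg (R : realType) (q : nat -> R) (x r : R) : 0 < x -> (forall n, 0 < q n) ->
  q n @[n --> \oo] --> x -> q n `^ r @[n --> \oo] --> x `^ r.
Proof.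
move=> x0 q0 qx; rewrite (_ : (fun n => _) = fun n => expR (r * ln (q n))).
  rewrite /powR gt_eqF//.
  have cl : ln (q n) @[n --> \oo] --> ln x.
    by apply: (continuous_cvg _ _ qx); exact: continuous_ln.
  have crl : r * ln (q n) @[n --> \oo] --> r * ln x by exact: cvgMl_tmp.
  by apply: (continuous_cvg _ _ crl); exact: continuous_expR.
by apply/funext => n; rewrite /powR gt_eqF.
Qed.

Section ScaledProcesses.
Context {R : realType} d (T : measurableType d) (P : probability T R).
Context (TT : set R) (hTT : time_domain TT) (X : R -> T -> R)
  (hX : stochastic_process TT X).

Lemma time_domainM a t : 0 < a -> TT t -> TT (a * t).
Proof.
move=> a0; case: hTT => ->//=; rewrite !in_itv/= !andbT.
  exact: mulr_ge0 (ltW a0).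
exact: mulr_gt0.
Qed.

Lemma char_fun_fd_vector_scale a b k (t : 'I_k -> R) theta :
  char_fun P (fd_vector (fun t w => a * X (b * t) w) t) theta =
  char_fun P (fd_vector X (fun j => b * t j)) (a *: theta).
Proof.
rewrite -char_funZ; congr (char_fun P _ theta); apply/funext => w.
by apply: eq_from_tnth => j; rewrite !tnth_mktuple.
Qed.

Lemma char_fun_copies_sum m d' (T' : measurableType d') (P' : probability T' R)
    (Y : 'I_m -> R -> T' -> R) k (t : 'I_k -> R) theta :
  (forall i, stochastic_process TT (Y i)) -> independent_processes P' TT Y ->
  (forall i, same_fdd P' P TT (Y i) X) -> (0 < k)%N -> (forall j, TT (t j)) ->
  char_fun P' (fd_vector (fun t w => \sum_(i < m) Y i t w) t) theta =
  char_fun P (fd_vector X t) theta ^+ m.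
Proof.
move=> mY iY sY k0 Tt.
have mYt i : measurable_fun [set: T'] (fd_vector (Y i) t).
  by apply: measurable_fd_vector => j; exact: mY.
have mXt : measurable_fun [set: T] (fd_vector X t).
  by apply: measurable_fd_vector => j; exact: hX.
have iYt : independent_vectors P' (fun i => fd_vector (Y i) t).
  move=> A FA; apply: iY => i; have [B mB <-] := FA i.
  (* A finite-dimensional vector is measurable for the sigma-algebra of the
     whole process. *)
  have : measurable_fun [set: g_sigma_algebraType (\bigcup_(t in TT)
      preimage_set_system [set: T'] (Y i t) measurable)] (fd_vector (Y i) t).
    apply: measurable_fd_vector => j _ C mC; apply: sub_sigma_algebra.
    by exists (t j) => //; exists C.
  by move=> /(_ measurableT B mB).
rewrite (_ : fd_vector _ t = fun w =>
    [tuple \sum_(i < m) tnth (fd_vector (Y i) t w) j | j < k]); last first.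
  apply/funext => w; apply: eq_from_tnth => j; rewrite !tnth_mktuple.
  by apply: eq_bigr => i _; rewrite tnth_mktuple.
rewrite char_fun_sum// (eq_bigr (fun=> char_fun P (fd_vector X t) theta)).
  by rewrite prodr_const card_ord.
by move=> i _; rewrite (same_law_char_fun (mYt i) mXt (sY i k t k0 Tt)).
Qed.

(** Dilative stability is used at T = m^(1/delta), for which T^delta = m and
    T^(alpha - delta/2) = m^(-rho). *)
Lemma dilatively_stable_aggregate_similar alpha delta : delta != 0 ->
  dilatively_stable P TT alpha delta X ->
  aggregate_similar P TT (1 / 2 - alpha / delta) (- (1 / delta)) X.
Proof.
move=> d0 [idX dsX] m m0 d' T' P' Y mY iY sY k t k0 Tt.
rewrite opprK; set rho := _ - _; set M := m%:R `^ (1 / delta).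
have mR : 0 < m%:R :> R by rewrite ltr0n.
have M0 : 0 < M by exact: powR_gt0.
have TMt j : TT (M * t j) by exact: time_domainM.
have mXt : measurable_fun [set: T] (fd_vector X t).
  by apply: measurable_fd_vector => j; exact: hX.
have mXMt : measurable_fun [set: T] (fd_vector X (fun j => M * t j)).
  by apply: measurable_fd_vector => j; exact: hX.
have [_ _ psiE] := id_char_exponentP mXt (idX k t k0 Tt).
have [_ _ psiME] := id_char_exponentP mXMt (idX k _ k0 TMt).
apply: char_fun_inj.
- apply: measurable_fd_vector => j; apply: measurable_sum => i.
  exact: mY.
- apply: measurable_fd_vector => j; apply: measurable_funM => //.
  exact: hX.
apply/funext => theta; rewrite (char_fun_copies_sum _ mY iY sY k0 Tt).
rewrite char_fun_fd_vector_scale psiME dsX// psiE -cexp_natl mulrN scalerA.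
have -> : M `^ delta = m%:R by rewrite -powRrM divfK// powRr1// ler0n.
have -> : M `^ (alpha - delta / 2) * m%:R `^ rho = 1.
  rewrite -powRrM powRD_gt0//.
  by rewrite (_ : _ + _ = 0) ?powRr0// /rho; field.
by rewrite scale1r rmorph_nat.
Qed.

(** Aggregate similarity only makes an assertion about given copies of X, so it is
    applied to the copies from independent_process_copies. *)
Lemma aggregate_similar_char_fun rho1 rho2 m k (t : 'I_k -> R) theta :
  aggregate_similar P TT rho1 rho2 X -> (0 < m)%N -> (0 < k)%N ->
  (forall j, TT (t j)) ->
  char_fun P (fd_vector X (fun j => m%:R `^ (- rho2) * t j)) (m%:R `^ rho1 *: theta) =
  char_fun P (fd_vector X t) theta ^+ m.
Proof.
move=> asX m0 k0 Tt.
have [d' [T' [P' [Y [mY iY sY]]]]] := independent_process_copies P m hX.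
rewrite -(char_fun_copies_sum theta mY iY sY k0 Tt) -char_fun_fd_vector_scale.
have mR : 0 < m%:R :> R by rewrite ltr0n.
apply/esym; move: theta; apply/funeqP; apply: same_law_char_fun.
- apply: measurable_fd_vector => j; apply: measurable_sum => i.
  exact: mY.
- apply: measurable_fd_vector => j; apply: measurable_funM => //.
  by apply: hX; apply: time_domainM => //; exact: powR_gt0.
exact: (asX m m0 d' T' P' Y mY iY sY k t k0 Tt).
Qed.

Lemma is_char_exponent_scale k (Z Z' : T -> k.-tuple R) psi (q a : R) :
  is_char_exponent P Z psi ->
  (forall theta, char_fun P Z' theta = cexp (- (q%:C%C * psi (a *: theta)))) ->
  is_char_exponent P Z' (fun theta => q%:C%C * psi (a *: theta)).
Proof.
move=> [/continuous_complexP[cr ci] psi0 _] E; split => //.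
  have ReE x : complex.Re (q%:C%C * psi (a *: x)) = q * complex.Re (psi (a *: x)).
    by case: (psi _) => u v /=; rewrite mul0r subr0.
  have ImE x : complex.Im (q%:C%C * psi (a *: x)) = q * complex.Im (psi (a *: x)).
    by case: (psi _) => u v /=; rewrite mul0r addr0.
  apply/continuous_complexP; split.
    by rewrite (funext ReE); exact: (continuous_dilate (q := q) (a := a) cr).
  by rewrite (funext ImE); exact: (continuous_dilate (q := q) (a := a) ci).
by rewrite scaler0 psi0 mulr0.
Qed.

Section AggregateToDilative.
Context (rho1 rho2 : R) (idX : infinitely_divisible P TT X)
  (wcX : weakly_right_continuous P TT X)
  (asX : aggregate_similar P TT rho1 rho2 X).

Let psi k (t : 'I_k -> R) := char_exponent P (fd_vector X t).

Let psiP k (t : 'I_k -> R) : (0 < k)%N -> (forall j, TT (t j)) ->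
  is_char_exponent P (fd_vector X t) (psi t).
Proof.
move=> k0 Tt; apply: id_char_exponentP; last exact: idX.
by apply: measurable_fd_vector => j; exact: hX.
Qed.

Let psi_nat m k (t : 'I_k -> R) theta : (0 < m)%N -> (0 < k)%N ->
  (forall j, TT (t j)) ->
  psi (fun j => m%:R `^ (- rho2) * t j) theta =
  m%:R * psi t (m%:R `^ (- rho1) *: theta).
Proof.
move=> m0 k0 Tt; have mR : 0 < m%:R :> R by rewrite ltr0n.
have Tmt j : TT (m%:R `^ (- rho2) * t j).
  by apply: time_domainM => //; exact: powR_gt0.
rewrite {1}/psi (char_exponentE
  (psi := fun theta => (m%:R)%:C%C * psi t (m%:R `^ (- rho1) *: theta))).
  by rewrite rmorph_nat.
apply: is_char_exponent_scale (psiP k0 Tt) _ => eta.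
have := aggregate_similar_char_fun (m%:R `^ (- rho1) *: eta) asX m0 k0 Tt.
rewrite scalerA powRD_gt0// subrr powRr0 scale1r.
by move=> ->; have [_ _ ->] := psiP k0 Tt; rewrite rmorph_nat -mulrN cexp_natl.
Qed.

(** Both sides are compared after a further scaling of time by m^(-rho2), since
    p^(-rho2) = m^(-rho2) q^(-rho2). *)
Let psi_rat (p m : nat) k (t : 'I_k -> R) theta : (0 < p)%N -> (0 < m)%N ->
  (0 < k)%N -> (forall j, TT (t j)) -> let q : R := p%:R / m%:R in
  psi (fun j => q `^ (- rho2) * t j) theta =
  q%:C%C * psi t (q `^ (- rho1) *: theta).
Proof.
move=> p0 m0 k0 Tt q.
have pR : 0 < p%:R :> R by rewrite ltr0n.
have mR : 0 < m%:R :> R by rewrite ltr0n.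
have q0 : 0 < q by exact: divr_gt0.
have Tqt j : TT (q `^ (- rho2) * t j).
  by apply: time_domainM => //; exact: powR_gt0.
have pE r : p%:R `^ r = m%:R `^ r * q `^ r.
  by rewrite -powRM ?ltW// /q mulrCA divff ?mulr1// gt_eqF.
have mrho (r : R) : m%:R `^ (- r) * m%:R `^ r = 1.
  by rewrite powRD_gt0// addNr powRr0.
have := psi_nat (m%:R `^ rho1 *: theta) p0 k0 Tt.
have -> : (fun j => p%:R `^ (- rho2) * t j) =
    (fun j => m%:R `^ (- rho2) * (q `^ (- rho2) * t j)).
  by apply/funext => j; rewrite pE mulrA.
rewrite psi_nat// !scalerA mrho scale1r pE mulrAC mrho mul1r => E.
have mn0 : m%:R != 0 :> R[i] by rewrite pnatr_eq0 -lt0n.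
apply: (mulfI mn0); rewrite E /q mulrA; congr (_ * _).
by rewrite rmorphM/= fmorphV !rmorph_nat mulrCA divff ?mulr1.
Qed.

(** For x > 0 take positive rationals q n tending to x. The times
    (q n)^(-rho2) u n j = max (x^(-rho2) t_j, (q n)^(-rho2) t_j) tend to
    x^(-rho2) t_j from the right, and the times u n j tend to t_j from the right,
    whatever the signs of the t_j and of q n - x. *)
Let psi_pos (x : R) k (t : 'I_k -> R) theta : 0 < x -> (0 < k)%N -> (forall j, TT (t j)) ->
  psi (fun j => x `^ (- rho2) * t j) theta = x%:C%C * psi t (x `^ (- rho1) *: theta).
Proof.
move=> x0 k0 Tt; have [p [p0 px]] := rational_cvg x0.
pose q n : R := (p n)%:R / n.+1%:R.
have q0 n : 0 < q n by rewrite divr_gt0 ?ltr0n.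
have X0 r : 0 < x `^ r by exact: powR_gt0.
have Q0 n r : 0 < q n `^ r by exact: powR_gt0.
have Txt j : TT (x `^ (- rho2) * t j) by exact: time_domainM.
pose u n j := Num.max (x `^ (- rho2) / q n `^ (- rho2) * t j) (t j).
have Tu n j : TT (u n j).
  rewrite /u /Num.max; case: ifP => _ //.
  by apply: time_domainM => //; exact: divr_gt0.
have Tqu n j : TT (q n `^ (- rho2) * u n j) by exact: time_domainM.
have tu n j : t j <= u n j by rewrite le_max lexx orbT.
have xtu n j : x `^ (- rho2) * t j <= q n `^ (- rho2) * u n j.
  rewrite /u (maxr_pMr _ _ (ltW (Q0 n (- rho2)))) le_max mulrA [X in _ <= X * _]mulrC divfK ?lexx//.
  by rewrite gt_eqF.
have cvQ : q n `^ (- rho2) @[n --> \oo] --> x `^ (- rho2) by exact: powR_cvg.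
have cvu j : u n j @[n --> \oo] --> t j.
  have cvr : x `^ (- rho2) / q n `^ (- rho2) * t j @[n --> \oo] --> t j.
    rewrite -[X in _ --> X]mul1r; apply: cvgMr_tmp.
    rewrite -(divff (lt0r_neq0 (X0 (- rho2)))); apply: cvgMl_tmp.
    by apply: cvgV => //; rewrite gt_eqF.
  apply: (@squeeze_cvgr _ _ _ _ (fun=> t j)
    (fun n => t j + `|x `^ (- rho2) / q n `^ (- rho2) * t j - t j|)).
  - near=> n; rewrite tu/= ge_max lerDl normr_ge0 andbT -lerBlDl.
    exact: ler_norm.
  - exact: cvg_cst.
  - rewrite -[X in _ --> X]addr0; apply: cvgD; first exact: cvg_cst.
    by rewrite -(normr0 R) -(subrr (t j)); apply: cvg_norm; apply: cvgB => //; exact: cvg_cst.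
have cvqu j : q n `^ (- rho2) * u n j @[n --> \oo] --> x `^ (- rho2) * t j.
  exact: cvgM.
have mX (s : 'I_k -> R) : (forall j, TT (s j)) -> measurable_fun [set: T] (fd_vector X s).
  by move=> Ts; apply: measurable_fd_vector => j; exact: hX.
have cd1 := wcX k0 Tt Tu tu cvu.
have cd2 := wcX k0 Txt Tqu xtu cvqu.
rewrite {1}/psi (char_exponentE
  (psi := fun theta => x%:C%C * psi t (x `^ (- rho1) *: theta)))//.
apply: is_char_exponent_scale (psiP k0 Tt) _ => eta.
have [cvRe cvIm] := char_exponent_cvg (fun n => mX _ (Tu n)) (mX _ Tt) cd1 eta
  (fun n => psiP k0 (Tu n)) (psiP k0 Tt) (powR_cvg (r := - rho1) x0 q0 px).
set z := psi t (x `^ (- rho1) *: eta) in cvRe cvIm *.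
pose zn n := psi (u n) (q n `^ (- rho1) *: eta).
have En n : char_fun P (fd_vector X (fun j => q n `^ (- rho2) * u n j)) eta =
    cexp (- ((q n)%:C%C * zn n)).
  by have [_ _ ->] := psiP k0 (Tqu n); rewrite psi_rat.
have cvqr : - (q n * complex.Re (zn n)) @[n --> \oo] --> - (x * complex.Re z).
  by apply: cvgN; exact: cvgM.
have cvqi : - (q n * complex.Im (zn n)) @[n --> \oo] --> - (x * complex.Im z).
  by apply: cvgN; exact: cvgM.
have cexpE (y : R) (v : R[i]) : cexp (- (y%:C%C * v)) =
  (expR (- (y * complex.Re v)) * cos (- (y * complex.Im v)) +i*
   (expR (- (y * complex.Re v)) * sin (- (y * complex.Im v))))%C.
  by case: v => v1 v2; rewrite /cexp/= !mul0r subr0 addr0.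
have ce : expR (- (q n * complex.Re (zn n))) @[n --> \oo] --> expR (- (x * complex.Re z)).
  by apply: (continuous_cvg _ _ cvqr); exact: continuous_expR.
have cc : cos (- (q n * complex.Im (zn n))) @[n --> \oo] --> cos (- (x * complex.Im z)).
  by apply: (continuous_cvg _ _ cvqi); exact: continuous_cos.
have cs : sin (- (q n * complex.Im (zn n))) @[n --> \oo] --> sin (- (x * complex.Im z)).
  by apply: (continuous_cvg _ _ cvqi); exact: continuous_sin.
have lim_unique (g : R[i] -> R) (l : R) :
    (forall z z' e, coord_close e z z' -> `|g z - g z'| <= e) ->
    g (cexp (- ((q n)%:C%C * zn n))) @[n --> \oo] --> l ->
    g (char_fun P (fd_vector X (fun j => x `^ (- rho2) * t j)) eta) = l.
  move=> gclose cvl; apply: (cvg_unique _ _ cvl) => //.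
  apply/cvgrPdist_le => e e0; have := char_fun_cvg cd2 eta e0.
  by apply: filterS => n; rewrite En => /gclose; rewrite distrC.
apply: complex_ext.
- apply: lim_unique => [? ? ? []//|]; rewrite cexpE.
  under eq_fun do rewrite cexpE.
  exact: cvgM.
- apply: lim_unique => [? ? ? []//|]; rewrite cexpE.
  under eq_fun do rewrite cexpE.
  exact: cvgM.
Unshelve. all: by end_near. Qed.

Lemma aggregate_similar_dilatively_stable : rho2 != 0 ->
  dilatively_stable P TT (rho1 / rho2 - 1 / (2 * rho2)) (- (1 / rho2)) X.
Proof.
move=> r0; split => // x k theta t x0 k0 Tt.
pose y := x `^ (- (1 / rho2)).
have y0 : 0 < y by exact: powR_gt0.
have xE : x = y `^ (- rho2).
  by rewrite /y -powRrM mulrNN mul1r mulVf// powRr1// ltW.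
have bE : x `^ (rho1 / rho2 - 1 / (2 * rho2) - - (1 / rho2) / 2) = y `^ (- rho1).
  rewrite /y -powRrM; congr (_ `^ _); field; exact: r0.
by rewrite bE -/y {1}xE; exact: psi_pos.
Qed.

End AggregateToDilative.

End ScaledProcesses.

Theorem proposition1p5 (R : realType) (d : measure_display)
    (Omega : measurableType d) (P : probability Omega R)
    (TT : set R) (hTT : time_domain TT)
    (X : R -> Omega -> R) (hX : stochastic_process TT X) :
  (forall alpha delta : R, delta != 0 ->
     dilatively_stable P TT alpha delta X ->
     aggregate_similar P TT (1 / 2 - alpha / delta) (- (1 / delta)) X) /\
  (forall rho1 rho2 : R, rho2 != 0 ->
     infinitely_divisible P TT X ->
     weakly_right_continuous P TT X ->
     aggregate_similar P TT rho1 rho2 X ->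
     dilatively_stable P TT (rho1 / rho2 - 1 / (2 * rho2)) (- (1 / rho2)) X).
Proof.
split=> [alpha delta d0 dsX|rho1 rho2 r0 idX wcX asX].
  exact: dilatively_stable_aggregate_similar.
exact: aggregate_similar_dilatively_stable.
Qed.
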